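(* Let $\kappa>0$ and let $X$ be the total space of the spinor bundle over the round $S^3$ of constant curvature $\kappa$, equipped with the Bryant--Salamon $G_2$-holonomy structure given by the $3$-form $\gamma$. Let $A_1=\mathrm{Im}(a\bar\alpha)$, an $\mathfrak{su}(2)$-valued $1$-form on $X$, and $r=a\bar a$. For any constant $C>-3$ let $$f(r)=\frac{2}{3(r+1)+C(r+1)^{1/3}}.$$ Then the connection $\nabla=d+f(r)A_1$ defines a non-trivial $G_2$-instanton on the trivial rank $2$ complex vector bundle over $X$; that is, its curvature $F$ is not identically zero and satisfies $F\wedge *_\gamma\gamma=0$ on $X$. Moreover, these connections are invariant under the group $SU(2)^3$ of isometries of $X$.
   Context: Conventions. $\mathbb{H}$ denotes the quaternions, $SU(2)=S^3$ the unit quaternions, and $\mathrm{Im}\,\mathbb{H}\cong\mathfrak{su}(2)$ (acting on $\mathbb{C}^2$ by the standard representation). Products of $\mathbb{H}$-valued forms are wedge products combined with quaternion multiplication; bar, $\mathrm{Re}$, $\mathrm{Im}$ are applied to values. Upper multi-indices denote wedge products, e.g. $\omega^{23}=\omega^2\wedge\omega^3$. The manifold $X$. Let $\tilde{\mathcal F}\to S^3$ be the spin double cover of the orthonormal coframe bundle, a principal right $SU(2)$-bundle, with canonical form $\omega=\omega^1i+\omega^2j+\omega^3k$ and Levi-Civita connection form $\phi$ (both $\mathrm{Im}\,\mathbb H$-valued), satisfying $R_q^*\omega=\bar q\omega q$, $R_q^*\phi=\bar q\phi q+\bar q\,dq$ (so $\bar q\phi q$ for constant $q$), $d\omega=-\omega\wedge\phi-\phi\wedge\omega$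 and $d\phi+\phi\wedge\phi=-\frac{\kappa}{2}\Omega$, where $\Omega=\frac12\omega\wedge\omega=\omega^{23}i+\omega^{31}j+\omega^{12}k$. Concretely $\tilde{\mathcal F}=SU(2)\times SU(2)$ with $SU(2)$ acting by diagonal right multiplication, $\phi=\frac12(\theta_1+\theta_2)$, $\omega=\kappa^{-1/2}(\theta_1-\theta_2)$, where $\theta_i=g_i^{-1}dg_i$ are the Maurer--Cartan forms of the two factors. Then $X=(\tilde{\mathcal F}\times\mathbb H)/SU(2)$ with $q$ acting by $(p,v)\mapsto(pq,vq)$. Let $a:\tilde{\mathcal F}\times\mathbb H\to\mathbb H$ be the projection, $\alpha=da-a\phi=\alpha^0+\alpha^1i+\alpha^2j+\alpha^3k$, and $B=\frac12\bar\alpha\wedge\alpha=B^1i+B^2j+B^3k$ with $B^1=\alpha^{01}-\alpha^{23}$, $B^2=\alpha^{02}-\alpha^{31}$, $B^3=\alpha^{03}-\alpha^{12}$. A form on $\tilde{\mathcal F}\times\mathbb H$ that is $SU(2)$-invariant and vanishes on contraction with vectors tangent to the $SU(2)$-orbits is identified with a form on $X$; this applies to $r=|a|^2$, $A_1=\mathrm{Im}(a\bar\alpha)$ and all forms below. The $G_2$-structure. Put $\gamma_1=\omega^{123}$, $\gamma_2=\sum_i\omega^i\wedge B^i$, $\psi_1=\alpha^{0123}$, $\psi_2=\omega^{23}\wedge B^1+\omega^{31}\wedge B^2+\omega^{12}\wedge B^3$. The Bryant--Salamon structure is $$\gamma=(3\kappa)^{3/2}(1+r)\gamma_1+4(3\kappa)^{1/2}\gamma_2,\qquad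 *_\gamma\gamma=16(1+r)^{-2/3}\psi_1-12\kappa(1+r)^{1/3}\psi_2,$$ both closed; the associated complete metric is $g_\gamma=3\kappa(1+r)^{2/3}\sum_i(\omega^i)^2+4(1+r)^{-1/3}\sum_i(\alpha^i)^2$. Instantons. A $G_2$-instanton is a connection with curvature $F$ satisfying $F\wedge *_\gamma\gamma=0$. For $\nabla=d+A$, $F=dA+A\wedge A$. Symmetry. $SU(2)^3$ acts on $X$ by isometries via $(h_1,h_2,h_3)\cdot[g_1,g_2,v]=[h_1g_1,h_2g_2,h_3v]$. A connection on the trivial bundle $X\times\mathbb C^2$ is invariant under $SU(2)^3$ if this action lifts to an action on $X\times\mathbb{C}^2$ by bundle automorphisms preserving the connection. *)

(* Defs.v *)
From HB Require Import structures.
From mathcomp Require Import all_boot all_order all_algebra all_fingroup.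
From mathcomp Require Import complex.
From mathcomp Require Import all_classical all_reals all_analysis.

Set Implicit Arguments.
Unset Strict Implicit.
Unset Printing Implicit Defensive.

Import Order.TTheory GRing.Theory Num.Theory.
Import numFieldNormedType.Exports.

Local Open Scope ring_scope.

(* The manifold X = (SU(2) x SU(2) x H) / SU(2) is handled through its total
   space P = SU(2) x SU(2) x H, a closed submanifold of the vector space
   E = H^3 (ambient R).  Forms on P are restrictions of forms on E, i.e. forms on E
   evaluated at points of P (in_P) on vectors tangent to P (tangent_P); the
   exterior derivative commutes with this restriction.  Forms on X are the
   invariant horizontal (basic) forms on P, functions on X are the invariant
   functions on P, and a form on X vanishes iff its pullback to P does. *)

Notation quat R := 'rV[R]_4.
Notation ambient R := (quat R * quat R * quat R)%type.

Section Quaternions.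
Context {R : realType}.
Implicit Types p q : quat R.

Definition qmk (a b c d : R) : quat R := \row_(l < 4) [:: a; b; c; d]`_l.

Definition qc (l : nat) q : R := q 0 (inord l).

Definition qone : quat R := qmk 1 0 0 0.

Definition qmul p q : quat R := qmk
  (qc 0 p * qc 0 q - qc 1 p * qc 1 q - qc 2 p * qc 2 q - qc 3 p * qc 3 q)
  (qc 0 p * qc 1 q + qc 1 p * qc 0 q + qc 2 p * qc 3 q - qc 3 p * qc 2 q)
  (qc 0 p * qc 2 q - qc 1 p * qc 3 q + qc 2 p * qc 0 q + qc 3 p * qc 1 q)
  (qc 0 p * qc 3 q + qc 1 p * qc 2 q - qc 2 p * qc 1 q + qc 3 p * qc 0 q).

Definition qconj q : quat R := qmk (qc 0 q) (- qc 1 q) (- qc 2 q) (- qc 3 q).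

Definition qim q : quat R := qmk 0 (qc 1 q) (qc 2 q) (qc 3 q).

Definition qnorm2 q : R := qc 0 (qmul q (qconj q)).

Definition in_SU2 q : Prop := qnorm2 q = 1.

Definition imaginary q : Prop := qc 0 q = 0.

(* The standard representation of SU(2) on C^2, extended to a morphism of
   real algebras from H to M_2(C); it identifies Im H with su(2). *)
Definition std_rep q : 'M[R[i]]_2 := \matrix_(m < 2, n < 2)
  if m == 0 then
    (if n == 0 then Complex (qc 0 q) (qc 1 q) else Complex (qc 2 q) (qc 3 q))
  else
    (if n == 0 then Complex (- qc 2 q) (qc 3 q)
               else Complex (qc 0 q) (- qc 1 q)).

End Quaternions.

Section Manifold.
Context {R : realType}.
Implicit Types x v h : ambient R.

Definition in_P x : Prop := in_SU2 x.1.1 /\ in_SU2 x.1.2.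

(* v.1.m = g xi with xi imaginary, where g = x.1.m is a unit quaternion *)
Definition tangent_P x v : Prop :=
  imaginary (qmul (qconj x.1.1) v.1.1) /\ imaginary (qmul (qconj x.1.2) v.1.2).

(* Diagonal right multiplication.  It is linear in x, so raction v q is also the
   image of a tangent vector v under the differential of the action of q; it
   is linear in q, so for xi imaginary, raction x xi is the value at x of the
   vector field generated by xi. *)
Definition raction x (q : quat R) : ambient R :=
  (qmul x.1.1 q, qmul x.1.2 q, qmul x.2 q).

Definition in_SU2cube h : Prop :=
  [/\ in_SU2 h.1.1, in_SU2 h.1.2 & in_SU2 h.2].

Definition one3 : ambient R := (qone, qone, qone).

(* The left action of SU(2)^3, its differential, and, when both arguments are
   in SU(2)^3, the group law. *)
Definition laction h x : ambient R :=
  (qmul h.1.1 x.1.1, qmul h.1.2 x.1.2, qmul h.2 x.2).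

End Manifold.

Section Smooth.
Context {R : realType} {V : normedModType R}.

Fixpoint diffn (n : nat) (f : V -> R) : Prop :=
  (forall x, differentiable f x) /\
  match n with
  | 0 => True
  | m.+1 => forall v, diffn m ('D_v f)
  end.

Definition smooth (f : V -> R) : Prop := forall n, diffn n f.

Definition smooth_mx (F : V -> 'M[R[i]]_2) : Prop := forall m n,
  smooth (fun x => complex.Re (F x m n)) /\
  smooth (fun x => complex.Im (F x m n)).

Definition derive_cmx (F : V -> 'M[R[i]]_2) (x v : V) : 'M[R[i]]_2 :=
  \matrix_(m < 2, n < 2)
    Complex ('D_v (fun y => complex.Re (F y m n)) x)
            ('D_v (fun y => complex.Im (F y m n)) x).

End Smooth.

Section Forms.
Context {R : realType}.

(* k-forms on E with values in V; the constructions below are the usual ones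
   on alternating multilinear maps *)
Definition kform (k : nat) (V : Type) : Type :=
  ambient R -> ('I_k -> ambient R) -> V.

Definition form_wedge {U V : Type} {K : fieldType} {W : lmodType K}
    (m : U -> V -> W) {k l : nat} (eta : kform k U) (zeta : kform l V) :
    kform (k + l) W :=
  fun x v => ((k`! * l`!)%N%:R : K)^-1 *:
    \sum_(s : 'S_(k + l)) (-1) ^+ s *:
      m (eta x (fun a => v (s (lshift l a))))
        (zeta x (fun b => v (s (rshift k b)))).

Definition rwedge {k l : nat} (eta : kform k R) (zeta : kform l R) :
    kform (k + l) R :=
  @form_wedge R R R R^o (fun s t : R => s * t) k l eta zeta.

Definition cmx_wedge {k l : nat} (eta : kform k 'M[R[i]]_2)
    (zeta : kform l 'M[R[i]]_2) : kform (k + l) 'M[R[i]]_2 :=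
  form_wedge (fun M N : 'M[R[i]]_2 => M *m N) eta zeta.

Definition cmx_rwedge {k l : nat} (eta : kform k 'M[R[i]]_2)
    (zeta : kform l R) : kform (k + l) 'M[R[i]]_2 :=
  form_wedge (fun (M : 'M[R[i]]_2) (t : R) => Complex t 0 *: M) eta zeta.

(* v i and the v (lift i j) are constant vector fields on E, so there are no
   bracket terms *)
Definition ext_d {k : nat} (eta : kform k 'M[R[i]]_2) : kform k.+1 'M[R[i]]_2 :=
  fun x v => \sum_(i < k.+1) (-1) ^+ i *:
    derive_cmx (fun y => eta y (fun j => v (lift i j))) x (v i).

Definition basic {k : nat} {V : nmodType} (eta : kform k V) : Prop :=
  (forall (q : quat R) (x : ambient R) (v : 'I_k -> ambient R),
     in_SU2 q -> in_P x -> (forall i, tangent_P x (v i)) ->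
     eta (raction x q) (fun i => raction (v i) q) = eta x v) /\
  (forall (x : ambient R) (v : 'I_k -> ambient R) (xi : quat R) (i : 'I_k),
     in_P x -> (forall j, tangent_P x (v j)) -> imaginary xi ->
     v i = raction x xi -> eta x v = 0).

End Forms.
Arguments kform R k V : clear implicits.

Section Connections.
Context {R : realType}.
Implicit Types A : kform R 1 'M[R[i]]_2.

(* d + A is a smooth connection on the trivial bundle X x C^2 *)
Definition is_connection A : Prop :=
  [/\ forall (x u w : ambient R) (c : R),
        A x (fun=> c *: u + w) =
        Complex c 0 *: A x (fun=> u) + A x (fun=> w),
      forall v, smooth_mx (fun x => A x v)
    & basic A].

Definition curvature A : kform R 2 'M[R[i]]_2 :=
  fun x v => ext_d A x v + cmx_wedge A A x v.

Definition nonflat A : Prop :=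
  exists (x : ambient R) (v : 'I_2 -> ambient R),
    [/\ in_P x, forall i, tangent_P x (v i) & curvature A x v != 0].

(* A G2-structure on X, given with its metric and the Hodge dual of its
   defining 3-form *)
Record G2_structure := {
  G2_form : kform R 3 R;
  G2_dual_form : kform R 4 R;
  G2_metric : ambient R -> ambient R -> ambient R -> R }.

Definition is_G2_instanton (G : G2_structure) A : Prop :=
  is_connection A /\
  forall (x : ambient R) (v : 'I_6 -> ambient R),
    in_P x -> (forall i, tangent_P x (v i)) ->
    cmx_rwedge (curvature A) (G2_dual_form G) x v = 0.

Definition SU2cube_isometric (G : G2_structure) : Prop :=
  forall h x u w : ambient R, in_SU2cube h -> in_P x ->
    tangent_P x u -> tangent_P x w ->
    G2_metric G (laction h x) (laction h u) (laction h w) = G2_metric G x u w.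

(* The lift is (h, (x, w)) |-> (laction h x, Phi (h, x) *m w): a smooth action of
   SU(2)^3 on X x C^2 by complex linear isomorphisms of the fibres.  It maps a
   section s to the section h.s with (h.s)(laction h x) = Phi (h, x) *m s x, and
   the last clause says nabla (h.s) = h.(nabla s) for every s.  Smooth
   functions on the closed submanifold SU(2)^3 x P extend to E x E. *)
Definition SU2cube_invariant A : Prop :=
  exists Phi : ambient R * ambient R -> 'M[R[i]]_2,
  [/\ smooth_mx Phi,
      forall h x, in_SU2cube h -> in_P x ->
        Phi (h, x) \in unitmx /\
        forall q, in_SU2 q -> Phi (h, raction x q) = Phi (h, x),
      forall x, in_P x -> Phi (one3, x) = 1%:M,
      forall h h' x, in_SU2cube h -> in_SU2cube h' -> in_P x ->
        Phi (laction h h', x) = Phi (h, laction h' x) *m Phi (h', x)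
    & forall h x v, in_SU2cube h -> in_P x -> tangent_P x v ->
        derive_cmx (fun y => Phi (h, y)) x v +
          A (laction h x) (fun=> laction h v) *m Phi (h, x) =
        Phi (h, x) *m A x (fun=> v)].

End Connections.
Arguments G2_structure R : clear implicits.

Section BryantSalamon.
Context {R : realType}.
Implicit Type x : ambient R.

(* theta_1 and theta_2; on P, the inverse of g is its conjugate *)
Definition theta1 x (v : ambient R) : quat R := qmul (qconj x.1.1) v.1.1.
Definition theta2 x (v : ambient R) : quat R := qmul (qconj x.1.2) v.1.2.

Definition phi x (v : ambient R) : quat R := 2^-1 *: (theta1 x v + theta2 x v).

Definition omega (kappa : R) x (v : ambient R) : quat R :=
  kappa `^ (- 2^-1) *: (theta1 x v - theta2 x v).

Definition alpha x (v : ambient R) : quat R := v.2 - qmul x.2 (phi x v).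

Definition omega_ (kappa : R) (i : nat) : kform R 1 R :=
  fun x v => qc i (omega kappa x (v 0)).

Definition alpha_ (i : nat) : kform R 1 R := fun x v => qc i (alpha x (v 0)).

Definition rr x : R := qnorm2 x.2.

Definition A1 x (v : ambient R) : quat R := qim (qmul x.2 (qconj (alpha x v))).

Local Notation "eta /*\ zeta" := (rwedge eta zeta)
  (at level 40, left associativity).

Definition om2 (kappa : R) (i j : nat) : kform R 2 R :=
  omega_ kappa i /*\ omega_ kappa j.

Definition al2 (i j : nat) : kform R 2 R := alpha_ i /*\ alpha_ j.

Definition B1 : kform R 2 R := fun x v => al2 0 1 x v - al2 2 3 x v.
Definition B2 : kform R 2 R := fun x v => al2 0 2 x v - al2 3 1 x v.
Definition B3 : kform R 2 R := fun x v => al2 0 3 x v - al2 1 2 x v.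

Definition gamma1 (kappa : R) : kform R 3 R :=
  omega_ kappa 1 /*\ omega_ kappa 2 /*\ omega_ kappa 3.

Definition gamma2 (kappa : R) : kform R 3 R := fun x v =>
  (omega_ kappa 1 /*\ B1) x v + (omega_ kappa 2 /*\ B2) x v +
  (omega_ kappa 3 /*\ B3) x v.

Definition psi1 : kform R 4 R :=
  alpha_ 0 /*\ alpha_ 1 /*\ alpha_ 2 /*\ alpha_ 3.

Definition psi2 (kappa : R) : kform R 4 R := fun x v =>
  (om2 kappa 2 3 /*\ B1) x v + (om2 kappa 3 1 /*\ B2) x v +
  (om2 kappa 1 2 /*\ B3) x v.

Definition bryant_salamon (kappa : R) : G2_structure R := {|
  G2_form := fun x v =>
    (3 * kappa) `^ (3 / 2) * (1 + rr x) * gamma1 kappa x v +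
    4 * (3 * kappa) `^ (1 / 2) * gamma2 kappa x v;
  G2_dual_form := fun x v =>
    16 * (1 + rr x) `^ (- (2 / 3)) * psi1 x v -
    12 * kappa * (1 + rr x) `^ (1 / 3) * psi2 kappa x v;
  G2_metric := fun x u w =>
    3 * kappa * (1 + rr x) `^ (2 / 3) *
      \sum_(1 <= i < 4) qc i (omega kappa x u) * qc i (omega kappa x w) +
    4 * (1 + rr x) `^ (- (1 / 3)) *
      \sum_(0 <= i < 4) qc i (alpha x u) * qc i (alpha x w) |}.

Definition ff (C r : R) : R := 2 / (3 * (r + 1) + C * (r + 1) `^ (1 / 3)).

Definition instanton_form (C : R) : kform R 1 'M[R[i]]_2 :=
  fun x v => std_rep (ff C (rr x) *: A1 x (v 0)).

End BryantSalamon.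

(* Main.v *)
(* With f evaluated at r, the curvature of d + f A_1 is
     F = f' dr /\ A_1 + f (alpha /\ \bar alpha - kappa/2 a Omega \bar a)
         + f^2 A_1 /\ A_1.
   Modulo self-dual forms its alpha /\ alpha part is - (f' + f^2) a B \bar a,
   so that F /\ *gamma is a multiple of a Omega \bar a /\ alpha^0123 and
   vanishes iff f' + f^2 = - f / (3 (1 + r)), which the given f satisfies.
   Since alpha(h p) = h_3 alpha(p), the constant lift h |-> h_3 preserves the
   connection; F is nonzero along the fibre directions at a = 0. *)
From HB Require Import structures.
Require Import Defs.
From mathcomp Require Import all_boot all_order all_algebra all_fingroup.
From mathcomp Require Import complex ring lra.
From mathcomp Require Import all_classical all_reals all_analysis.

Set Implicit Arguments.
Unset Strict Implicit.
Unset Printing Implicit Defensive.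

Import Order.TTheory GRing.Theory Num.Theory.
Import numFieldNormedType.Exports.
Import Defs.
Local Open Scope ring_scope.

(** * Quaternions and the standard representation *)

(** The profile f solves a Bernoulli equation: with y = 1 / f, the condition f' + f^2 = - f / (3 (1
    + r)) becomes the linear equation y' = 1 + y / (3 (1 + r)), whose solutions are y = (3 (1 + r) +
    C (1 + r)^(1/3)) / 2. The bound C > -3 says that y is positive at r = 0, and then for all r >=
    0. The computational obstacle is that wedging a 2-form with a 4-form means summing over the 720
    permutations of six vectors. Both factors are therefore expanded in the seven 1-forms omega^i,
    alpha^i. A wedge of 1-forms is a determinant, so a product of expansions is read off from
    concatenated index lists, with signs found by sorting. Forms live on the ambient space, but the
    Maurer-Cartan equations and the fact that omega and phi are imaginary hold only on vectors
    tangent to P. Tangency thus enters exactly where these facts are used. *)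

Section QuaternionAlgebra.
Context {R : realType}.
Implicit Types (p q a : quat R) (c : R).

Lemma qc_mk (w x y z : R) :
  (qc 0 (qmk w x y z) = w) * (qc 1 (qmk w x y z) = x) *
  (qc 2 (qmk w x y z) = y) * (qc 3 (qmk w x y z) = z).
Proof. by rewrite /qc !mxE !inordK. Qed.

Lemma qcD l p q : qc l (p + q) = qc l p + qc l q.
Proof. by rewrite /qc mxE. Qed.

Lemma qcN l p : qc l (- p) = - qc l p.
Proof. by rewrite /qc mxE. Qed.

Lemma qcZ l c p : qc l (c *: p) = c * qc l p.
Proof. by rewrite /qc mxE. Qed.

Lemma qc_zero l : qc l (0 : quat R) = 0.
Proof. by rewrite /qc mxE. Qed.

Lemma qc_mul p q :
  (qc 0 (qmul p q) =
     qc 0 p * qc 0 q - qc 1 p * qc 1 q - qc 2 p * qc 2 q - qc 3 p * qc 3 q) *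
  (qc 1 (qmul p q) =
     qc 0 p * qc 1 q + qc 1 p * qc 0 q + qc 2 p * qc 3 q - qc 3 p * qc 2 q) *
  (qc 2 (qmul p q) =
     qc 0 p * qc 2 q - qc 1 p * qc 3 q + qc 2 p * qc 0 q + qc 3 p * qc 1 q) *
  (qc 3 (qmul p q) =
     qc 0 p * qc 3 q + qc 1 p * qc 2 q - qc 2 p * qc 1 q + qc 3 p * qc 0 q).
Proof. by rewrite !qc_mk. Qed.

Definition qcE := (qcD, qcN, qcZ, qc_zero, qc_mul, qc_mk).

(* [qc l] reads component 0 for l >= 4, as [inord] sends such l to 0. *)
Lemma qc_ind (Q : nat -> Prop) :
  (forall k l, inord k = inord l :> 'I_4 -> Q k -> Q l) ->
  Q 0%N -> Q 1%N -> Q 2 -> Q 3 -> forall l, Q l.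
Proof.
move=> QE Q0 Q1 Q2 Q3 l.
apply: (QE (@inord 3 l)); first exact: inord_val.
by case: (inord l) => -[|[|[|[|//]]]] /=.
Qed.

Lemma qext p q : qc 0 p = qc 0 q -> qc 1 p = qc 1 q -> qc 2 p = qc 2 q ->
  qc 3 p = qc 3 q -> p = q.
Proof.
move=> e0 e1 e2 e3; apply/rowP => m; rewrite -[m]inord_val.
by apply: (@qc_ind (fun l => qc l p = qc l q)) => // k l; rewrite /qc => ->.
Qed.

End QuaternionAlgebra.

Ltac qring := apply: qext; rewrite /qconj /qim /qone ?qcE; ring.

Section QuaternionIdentities.
Context {R : realType}.
Implicit Types (p q a : quat R) (c : R).

Lemma qmulA p q a : qmul p (qmul q a) = qmul (qmul p q) a.
Proof. qring. Qed.

Lemma qmulDl p q a : qmul (p + q) a = qmul p a + qmul q a.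
Proof. qring. Qed.

Lemma qmulDr p q a : qmul a (p + q) = qmul a p + qmul a q.
Proof. qring. Qed.

Lemma qmulNl p q : qmul (- p) q = - qmul p q.
Proof. qring. Qed.

Lemma qmulNr p q : qmul p (- q) = - qmul p q.
Proof. qring. Qed.

Lemma qmulZl c p q : qmul (c *: p) q = c *: qmul p q.
Proof. qring. Qed.

Lemma qmulZr c p q : qmul p (c *: q) = c *: qmul p q.
Proof. qring. Qed.

Lemma qmul1l p : qmul qone p = p.
Proof. qring. Qed.

Lemma qmul1r p : qmul p qone = p.
Proof. qring. Qed.

Lemma qconjM p q : qconj (qmul p q) = qmul (qconj q) (qconj p).
Proof. qring. Qed.

Lemma qconjD p q : qconj (p + q) = qconj p + qconj q.
Proof. qring. Qed.

Lemma qconjN p : qconj (- p) = - qconj p.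
Proof. qring. Qed.

Lemma qconjZ c p : qconj (c *: p) = c *: qconj p.
Proof. qring. Qed.

Lemma qconjK p : qconj (qconj p) = p.
Proof. qring. Qed.

Lemma qmul_conjr q : qmul q (qconj q) = qnorm2 q *: qone.
Proof. rewrite /qnorm2; qring. Qed.

Lemma qmul_conjl q : qmul (qconj q) q = qnorm2 q *: qone.
Proof. rewrite /qnorm2; qring. Qed.

Lemma SU2_mulVq q : in_SU2 q -> qmul (qconj q) q = qone.
Proof. by move=> q1; rewrite qmul_conjl q1 scale1r. Qed.

Lemma SU2_mulqV q : in_SU2 q -> qmul q (qconj q) = qone.
Proof. by move=> q1; rewrite qmul_conjr q1 scale1r. Qed.

Lemma qnorm2M p q : qnorm2 (qmul p q) = qnorm2 p * qnorm2 q.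
Proof. rewrite /qnorm2 /qconj !qcE; ring. Qed.

Lemma qnorm2E q :
  qnorm2 q = qc 0 q ^+ 2 + qc 1 q ^+ 2 + qc 2 q ^+ 2 + qc 3 q ^+ 2.
Proof. rewrite /qnorm2 /qconj !qcE; ring. Qed.

Lemma qnorm2_ge0 q : 0 <= qnorm2 q.
Proof. by rewrite qnorm2E !addr_ge0 ?sqr_ge0. Qed.

(** Conjugation by a unit fixes the real part, so it commutes with taking the imaginary part. This
    gives the equivariance of [A1] under the third factor of the left action. *)
Lemma qimM_SU2 h p : in_SU2 h ->
  qim (qmul (qmul h p) (qconj h)) = qmul (qmul h (qim p)) (qconj h).
Proof.
move=> h1; have -> : p = qc 0 p *: qone + qim p by qring.
rewrite qmulDr qmulDl qmulZr qmulZl qmul1r SU2_mulqV //.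
qring.
Qed.

Lemma imaginary_conj q : imaginary q -> qconj q = - q.
Proof. by move=> q0; apply: qext; rewrite !qcE ?q0 ?oppr0. Qed.

End QuaternionIdentities.


Section StdRep.
Context {R : realType}.
Implicit Types (p q : quat R) (c : R).

Lemma std_repE q :
  (std_rep q 0 0 = Complex (qc 0 q) (qc 1 q)) *
  (std_rep q 0 1 = Complex (qc 2 q) (qc 3 q)) *
  (std_rep q 1 0 = Complex (- qc 2 q) (qc 3 q)) *
  (std_rep q 1 1 = Complex (qc 0 q) (- qc 1 q)).
Proof. by rewrite !mxE. Qed.

Lemma ord2P (k : 'I_2) : (k = 0) \/ (k = 1).
Proof. by case: k => -[|[|//]] hk; [left | right]; apply: val_inj. Qed.

Lemma mx2P (T : Type) (M N : 'M[T]_2) :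
  M 0 0 = N 0 0 -> M 0 1 = N 0 1 -> M 1 0 = N 1 0 -> M 1 1 = N 1 1 -> M = N.
Proof.
move=> e00 e01 e10 e11; apply/matrixP => i j.
by case: (ord2P i) => ->; case: (ord2P j) => ->.
Qed.

Lemma std_repM p q : std_rep (qmul p q) = std_rep p *m std_rep q.
Proof.
apply: mx2P; rewrite !mxE big_ord_recl big_ord1 !mxE /=.
all: apply/eqP; rewrite eq_complex /= !qcE; apply/andP; split; apply/eqP.
all: ring.
Qed.

Lemma std_repD p q : std_rep (p + q) = std_rep p + std_rep q.
Proof.
apply: mx2P; rewrite [RHS]mxE !std_repE !qcE //.
  by rewrite opprD.
by rewrite opprD.
Qed.

Lemma std_repZ c q : std_rep (c *: q) = Complex c 0 *: std_rep q.
Proof.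
by apply: mx2P; rewrite [RHS]mxE !std_repE; apply/eqP;
  rewrite eq_complex /= !qcE; apply/andP; split; apply/eqP; ring.
Qed.

Lemma std_rep0 : std_rep (0 : quat R) = 0.
Proof. by apply: mx2P; rewrite [RHS]mxE !std_repE !qc_zero ?oppr0. Qed.

Lemma std_repN q : std_rep (- q) = - std_rep q.
Proof.
by apply/eqP; rewrite -addr_eq0 -std_repD addNr std_rep0.
Qed.

Lemma std_rep1 : std_rep (@qone R) = 1%:M.
Proof. by apply: mx2P; rewrite [RHS]mxE !std_repE /qone !qcE ?oppr0. Qed.

Lemma std_rep_eq0 q : std_rep q = 0 -> q = 0.
Proof.
move=> /matrixP q0; have := q0 0 0; have := q0 0 1.
by rewrite !std_repE !mxE => -[e2 e3] [e0 e1]; apply: qext; rewrite qc_zero.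
Qed.

Lemma std_rep_unit q : in_SU2 q -> std_rep q \in unitmx.
Proof.
move=> q1; apply: (proj1 (mulmx1_unit (B := std_rep (qconj q)) _)).
by rewrite -std_repM SU2_mulqV // std_rep1.
Qed.

End StdRep.

(** * Smooth functions and quaternion-valued derivatives *)

Section SmoothClosure.
Context {R : realType} {V : normedModType R}.
Implicit Types (f g : V -> R) (F G : V -> quat R).

Lemma diffn_differentiable n f x : diffn n f -> differentiable f x.
Proof. by case: n => [|n] []. Qed.

Lemma diffn_pred n f : diffn n.+1 f -> diffn n f.
Proof.
elim: n f => [|n IH] f [df Df]; first by split.
by split=> // v; exact/IH/Df.
Qed.

Lemma diffn_cst n (c : R) : diffn n ((fun=> c) : V -> R).
Proof.
elim: n c => [|n IH] c; first by split=> // x; exact: differentiable_cst.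
split=> [x|v]; first exact: differentiable_cst.
rewrite (_ : 'D_v _ = fun=> 0) //; apply/funext => x; exact: derive_cst.
Qed.

Lemma diffnD n f g : diffn n f -> diffn n g -> diffn n (fun x => f x + g x).
Proof.
elim: n f g => [|n IH] f g [df Df] [dg Dg].
  by split=> // x; exact: differentiableD.
split=> [x|v]; first exact: differentiableD.
rewrite (_ : 'D_v _ = fun x => 'D_v f x + 'D_v g x).
  by apply: IH; [exact: Df | exact: Dg].
by apply/funext => x; rewrite (@deriveD _ _ _ f g) //; exact: diff_derivable.
Qed.

Lemma diffnM n f g : diffn n f -> diffn n g -> diffn n (fun x => f x * g x).
Proof.
elim: n f g => [|n IH] f g nf ng.
  have [df _] := nf; have [dg _] := ng.
  by split=> // x; exact: differentiableM.
have [[df _] [dg _]] := (nf, ng).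
split=> [x|v]; first exact: differentiableM.
rewrite (_ : 'D_v _ = fun x => f x * 'D_v g x + g x * 'D_v f x).
  have [[_ /(_ v) Df] [_ /(_ v) Dg]] := (nf, ng).
  (* Each term pairs a derivative, known to order n, with an undifferentiated factor, which
     [diffn_pred] lowers to that order. *)
  by apply: diffnD; apply: IH;
    (first [exact: Df | exact: Dg | exact: diffn_pred]).
by apply/funext => x; rewrite (@deriveM _ _ f g) //; exact: diff_derivable.
Qed.

Lemma is_derive_powR_comp (a : R) f x v : differentiable f x -> 0 < f x ->
  is_derive x v (fun y => f y `^ a) (a * f x `^ (a - 1) * 'D_v f x).
Proof.
move=> df f0; have [dp Dp] := is_derive1_powR a f0.
have dp' : differentiable (@powR R ^~ a) (f x) by apply/derivable1_diffP.
have dc : differentiable ((@powR R ^~ a) \o f) x by exact: differentiable_comp.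
split; first exact: diff_derivable.
rewrite (deriveE _ dc) diff_comp //= deriv1E // derive1E Dp -deriveE //.
exact: mulrC.
Qed.

Lemma differentiable_powR_comp (a : R) f x : differentiable f x -> 0 < f x ->
  differentiable (fun y => f y `^ a) x.
Proof.
move=> df f0; apply: (@differentiable_comp _ _ _ _ f (@powR R ^~ a)) => //.
by apply/derivable1_diffP; case: (is_derive1_powR a f0).
Qed.

(** The induction is over all exponents at once, since differentiating replaces a by a - 1. *)
Lemma diffn_powR n (a : R) f : (forall x, 0 < f x) -> diffn n f ->
  diffn n (fun x => f x `^ a).
Proof.
move=> f0; elim: n a => [|n IH] a nf.
  split=> // x; apply: differentiable_powR_comp => //.
  exact: (diffn_differentiable x nf).
split=> [x|v].
  by apply: differentiable_powR_comp => //; exact: (diffn_differentiable x nf).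
rewrite (_ : 'D_v _ = fun x => (a * f x `^ (a - 1)) * 'D_v f x).
  have [_ /(_ v) Df] := nf.
  apply: diffnM; last exact: Df.
  by apply: diffnM; [exact: diffn_cst | exact/IH/diffn_pred].
apply/funext => x.
by have [_ ->] := is_derive_powR_comp a v (diffn_differentiable x nf) (f0 x).
Qed.

Lemma smooth_cst (c : R) : smooth ((fun=> c) : V -> R).
Proof. by move=> n; exact: diffn_cst. Qed.

Lemma smoothD f g : smooth f -> smooth g -> smooth (fun x => f x + g x).
Proof. by move=> sf sg n; exact: diffnD. Qed.

Lemma smoothM f g : smooth f -> smooth g -> smooth (fun x => f x * g x).
Proof. by move=> sf sg n; exact: diffnM. Qed.

Lemma smoothN f : smooth f -> smooth (fun x => - f x).
Proof.
move=> sf; rewrite (_ : (fun _ => _) = fun x => -1 * f x).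
  by apply: smoothM => //; exact: smooth_cst.
by apply/funext => x; rewrite mulN1r.
Qed.

Lemma smooth_powR (a : R) f : (forall x, 0 < f x) -> smooth f ->
  smooth (fun x => f x `^ a).
Proof. by move=> f0 sf n; exact: diffn_powR. Qed.

Lemma smooth_differentiable f x : smooth f -> differentiable f x.
Proof. by move=> /(_ 0%N); exact: diffn_differentiable. Qed.

Lemma is_derive_linear f x v : linear f -> continuous f ->
  is_derive x v f (f v).
Proof.
move=> linf cf.
pose fM := GRing.isLinear.Build _ _ _ _ f linf.
pose fL : {linear V -> R} := HB.pack f fM.
have df : differentiable fL x by exact: linear_differentiable.
by split; [exact: diff_derivable | rewrite (deriveE _ df) diff_lin].
Qed.

Lemma smooth_linear f : linear f -> continuous f -> smooth f.
Proof.
move=> linf cf.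
pose fM := GRing.isLinear.Build _ _ _ _ f linf.
pose fL : {linear V -> R} := HB.pack f fM.
have df x : differentiable f x by exact: (@linear_differentiable _ _ _ fL).
move=> [|n]; split=> // v.
rewrite (_ : 'D_v f = fun=> f v); first exact: diffn_cst.
by apply/funext => x; case: (is_derive_linear x v linf cf).
Qed.

End SmoothClosure.

Section QuaternionFunctions.
Context {R : realType} {V : normedModType R}.
Implicit Types (f g : V -> R) (F G : V -> quat R).

Definition qsmooth F := forall l, smooth (fun x => qc l (F x)).

(** Componentwise, to match [derive_cmx]: the real and imaginary parts of the entries of [std_rep]
    are the components up to sign. *)
Definition is_qderive (x v : V) F (dF : quat R) :=
  forall l, is_derive x v (fun y => qc l (F y)) (qc l dF).

Lemma qsmooth_ind F : smooth (fun x => qc 0 (F x)) ->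
  smooth (fun x => qc 1 (F x)) -> smooth (fun x => qc 2 (F x)) ->
  smooth (fun x => qc 3 (F x)) -> qsmooth F.
Proof. by move=> *; apply: qc_ind => // k l kl; rewrite /qc kl. Qed.

Lemma is_qderive_ind x v F dF :
  is_derive x v (fun y => qc 0 (F y)) (qc 0 dF) ->
  is_derive x v (fun y => qc 1 (F y)) (qc 1 dF) ->
  is_derive x v (fun y => qc 2 (F y)) (qc 2 dF) ->
  is_derive x v (fun y => qc 3 (F y)) (qc 3 dF) -> is_qderive x v F dF.
Proof. by move=> *; apply: qc_ind => // k l kl; rewrite /qc kl. Qed.

Lemma qsmooth_cst q : qsmooth (fun=> q).
Proof. by move=> l; exact: smooth_cst. Qed.

Lemma qsmoothD F G : qsmooth F -> qsmooth G -> qsmooth (fun x => F x + G x).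
Proof.
move=> sF sG l.
rewrite (_ : (fun _ => _) = fun x => qc l (F x) + qc l (G x)).
  by apply: smoothD; [exact: sF | exact: sG].
by apply/funext => x; rewrite qcD.
Qed.

Lemma qsmoothN F : qsmooth F -> qsmooth (fun x => - F x).
Proof.
move=> sF l; rewrite (_ : (fun _ => _) = fun x => - qc l (F x)).
  (apply smoothN; exact: sF).
by apply/funext => x; rewrite qcN.
Qed.

Lemma qsmoothZ f F : smooth f -> qsmooth F -> qsmooth (fun x => f x *: F x).
Proof.
move=> sf sF l; rewrite (_ : (fun _ => _) = fun x => f x * qc l (F x)).
  by apply: smoothM => //; exact: sF.
by apply/funext => x; rewrite qcZ.
Qed.

Lemma qsmooth_mk (f0 f1 f2 f3 : V -> R) :
  smooth f0 -> smooth f1 -> smooth f2 -> smooth f3 ->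
  qsmooth (fun x => qmk (f0 x) (f1 x) (f2 x) (f3 x)).
Proof.
by move=> s0 s1 s2 s3; apply: qsmooth_ind;
  under eq_fun do rewrite qc_mk.
Qed.

Lemma qsmooth_conj F : qsmooth F -> qsmooth (fun x => qconj (F x)).
Proof.
move=> sF; apply: qsmooth_mk;
  (first [exact: sF | (apply smoothN; exact: sF)]).
Qed.

Lemma qsmooth_im F : qsmooth F -> qsmooth (fun x => qim (F x)).
Proof.
by move=> sF; apply: qsmooth_mk; (first [exact: sF | exact: smooth_cst]).
Qed.

Lemma qsmoothM F G : qsmooth F -> qsmooth G ->
  qsmooth (fun x => qmul (F x) (G x)).
Proof.
by move=> sF sG; apply: qsmooth_mk;
  repeat first [exact: sF | exact: sG | apply smoothM | apply smoothD
               | apply smoothN].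
Qed.

Lemma smooth_mx_std_rep F : qsmooth F -> smooth_mx (fun x => std_rep (F x)).
Proof.
move=> sF m n; under eq_fun do rewrite mxE.
under [X in _ /\ smooth X]eq_fun do rewrite mxE.
by case: (m == 0); case: (n == 0); split=> /=;
  (first [exact: sF | (apply smoothN; exact: sF)]).
Qed.

Lemma is_qderive_cst x v q : is_qderive x v (fun=> q) 0.
Proof. by move=> l; rewrite qc_zero; exact: is_derive_cst. Qed.

Lemma is_qderiveD x v F G dF dG : is_qderive x v F dF -> is_qderive x v G dG ->
  is_qderive x v (fun y => F y + G y) (dF + dG).
Proof.
move=> DF DG l; under eq_fun do rewrite qcD.
by rewrite qcD; exact: (@is_deriveD _ _ _ _ _ _ _ _ _ (DF l) (DG l)).
Qed.

Lemma is_qderiveN x v F dF : is_qderive x v F dF ->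
  is_qderive x v (fun y => - F y) (- dF).
Proof.
move=> DF l; under eq_fun do rewrite qcN.
by rewrite qcN; exact: (@is_deriveN _ _ _ _ _ _ _ (DF l)).
Qed.

Lemma is_qderiveZ x v f df F dF : is_derive x v f df -> is_qderive x v F dF ->
  is_qderive x v (fun y => f y *: F y) (f x *: dF + df *: F x).
Proof.
move=> Df DF l; under eq_fun do rewrite qcZ.
rewrite qcD !qcZ [df * _]mulrC.
exact: (@is_deriveM _ _ _ _ _ _ _ _ Df (DF l)).
Qed.

Lemma is_qderiveM x v F G dF dG : is_qderive x v F dF -> is_qderive x v G dG ->
  is_qderive x v (fun y => qmul (F y) (G y)) (qmul (F x) dG + qmul dF (G x)).
Proof.
move=> DF DG; have D k l : is_derive x v (fun y => qc k (F y) * qc l (G y))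
    (qc k (F x) * qc l dG + qc k dF * qc l (G x)).
  rewrite [qc k dF * _]mulrC.
  exact: (@is_deriveM _ _ _ _ _ _ _ _ (DF k) (DG l)).
apply: is_qderive_ind; under eq_fun do rewrite qc_mul.
all: eapply is_derive_eq; first by
  repeat first [exact: D | apply is_deriveD | apply is_deriveN].
all: rewrite qcD !qc_mul; ring.
Qed.

Lemma is_qderive_conj x v F dF : is_qderive x v F dF ->
  is_qderive x v (fun y => qconj (F y)) (qconj dF).
Proof.
move=> DF; apply: is_qderive_ind; rewrite /qconj ?qc_mk;
  under eq_fun do rewrite qc_mk;
  (first [exact: DF | exact: (@is_deriveN _ _ _ _ _ _ _ (DF _))]).
Qed.

Lemma is_qderive_im x v F dF : is_qderive x v F dF ->
  is_qderive x v (fun y => qim (F y)) (qim dF).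
Proof.
move=> DF; apply: is_qderive_ind; rewrite /qim ?qc_mk;
  under eq_fun do rewrite qc_mk; (first [exact: DF | exact: is_derive_cst]).
Qed.

Lemma derive_cmx_std_rep x v F dF : is_qderive x v F dF ->
  derive_cmx (fun y => std_rep (F y)) x v = std_rep dF.
Proof.
move=> DF; have D l : 'D_v (fun y => qc l (F y)) x = qc l dF by case: (DF l).
have DN l : 'D_v (fun y => - qc l (F y)) x = - qc l dF.
  by case: (@is_deriveN _ _ _ _ _ _ _ (DF l)).
apply/matrixP => m n; rewrite !mxE.
under [X in Complex ('D_v X x)]eq_fun do rewrite mxE.
under [X in Complex _ ('D_v X x)]eq_fun do rewrite mxE.
by case: (m == 0); case: (n == 0) => /=; rewrite ?D ?DN.
Qed.

End QuaternionFunctions.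

(** * Wedge products of determinants *)

Section BlockPerm.
Context {k l : nat}.
Implicit Types (t : 'S_k) (u : 'S_l).

Definition block_fun t u (i : 'I_(k + l)) : 'I_(k + l) :=
  match fintype.split i with
  | inl a => lshift l (t a)
  | inr b => rshift k (u b)
  end.

Lemma block_fun_inj t u : injective (block_fun t u).
Proof.
move=> i j; rewrite /block_fun.
case: (split_ordP i) => a ->; case: (split_ordP j) => b -> /eqP.
- by rewrite (inj_eq (@lshift_inj _ _)) => /eqP /perm_inj ->.
- by rewrite eq_lrshift.
- by rewrite eq_rlshift.
- by rewrite (inj_eq (@rshift_inj _ _)) => /eqP /perm_inj ->.
Qed.

Definition block_perm t u : 'S_(k + l) := perm (@block_fun_inj t u).

Lemma block_perml t u a : block_perm t u (lshift l a) = lshift l (t a).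
Proof. by rewrite permE /block_fun (unsplitK (inl a)). Qed.

Lemma block_permr t u b : block_perm t u (rshift k b) = rshift k (u b).
Proof. by rewrite permE /block_fun (unsplitK (inr b)). Qed.

(** The permutation matrix is block diagonal, so its determinant is the product of the two signs.
    Working over the integers, where 1 and -1 differ, recovers the parity from the sign. *)
Lemma odd_block_perm t u : odd_perm (block_perm t u) = t (+) u.
Proof.
have : (-1) ^+ block_perm t u = (-1) ^+ t * (-1) ^+ u :> int.
  rewrite -!det_perm -(det_ublock _ 0); congr (\det _); apply/matrixP => i j.
  case: (split_ordP i) => a ->; case: (split_ordP j) => b ->;
    rewrite ?(block_mxEul, block_mxEur, block_mxEdl, block_mxEdr) !mxE
      ?block_perml ?block_permr ?(inj_eq (@lshift_inj _ _))
      ?(inj_eq (@rshift_inj _ _)) ?eq_lrshift ?eq_rlshift //.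
by rewrite -signr_addb; case: (odd_perm (block_perm t u)); case: (t (+) u).
Qed.

End BlockPerm.

Section WedgeDet.
Context {R : numFieldType} {V : Type}.

(* Leibniz: expanding both minors, the pair (t, u) contributes the permutation
   [block_perm t u * s], and all k! l! pairs give the same sum over s. *)
Lemma det_col_mx_shuffle k l (A : 'I_k -> V -> R) (B : 'I_l -> V -> R)
    (v : 'I_(k + l) -> V) :
  \sum_(s : 'S_(k + l)) (-1) ^+ s *
    (\det (\matrix_(i, j) A i (v (s (lshift l j)))) *
     \det (\matrix_(i, j) B i (v (s (rshift k j))))) =
  (k`! * l`!)%N%:R *
    \det (col_mx (\matrix_(i, j) A i (v j)) (\matrix_(i, j) B i (v j))).
Proof.
set M := col_mx _ _.
have E (s : 'S_(k + l)) (t : 'S_k) (u : 'S_l) :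
    (-1) ^+ s * ((-1) ^+ t * \prod_i A i (v (s (lshift l (t i)))) *
    ((-1) ^+ u * \prod_i B i (v (s (rshift k (u i)))))) =
    (-1) ^+ (block_perm t u * s)%g *
    \prod_i M i ((block_perm t u * s)%g i).
  rewrite big_split_ord /= odd_permM odd_block_perm.
  have -> : \prod_(i < k) M (lshift l i) ((block_perm t u * s)%g (lshift l i)) =
      \prod_i A i (v (s (lshift l (t i)))).
    by apply: eq_bigr => i _; rewrite permM block_perml col_mxEu mxE.
  have -> : \prod_(i < l) M (rshift k i) ((block_perm t u * s)%g (rshift k i)) =
      \prod_i B i (v (s (rshift k (u i)))).
    by apply: eq_bigr => i _; rewrite permM block_permr col_mxEd mxE.
    move: (odd_perm s) (odd_perm t) (odd_perm u) => os ot ou.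
  by rewrite !signr_addb mulrACA [LHS]mulrA; congr (_ * _); exact: mulrC.
transitivity (\sum_(s : 'S_(k + l)) \sum_(t : 'S_k) \sum_(u : 'S_l)
    (-1) ^+ (block_perm t u * s)%g * \prod_i M i ((block_perm t u * s)%g i)).
  apply: eq_bigr => s _; rewrite /determinant mulr_suml mulr_sumr.
  apply: eq_bigr => t _; rewrite mulr_sumr mulr_sumr; apply: eq_bigr => u _.
  by rewrite -E; congr (_ * (_ * _ * (_ * _))); apply: eq_bigr => i _;
    rewrite mxE.
rewrite exchange_big /= (eq_bigr (fun=> (l`!)%:R * \det M)) => [|t _].
  by rewrite sumr_const card_Sn natrM -mulrA [RHS]mulr_natl.
rewrite exchange_big /= (eq_bigr (fun=> \det M)) => [|u _].
  by rewrite sumr_const card_Sn [RHS]mulr_natl.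
by rewrite [RHS](reindex_inj (mulgI (block_perm t u))).
Qed.

End WedgeDet.

Lemma lift2 : (lift 0 0 = 1 :> 'I_2) * (lift 1 0 = 0 :> 'I_2).
Proof. by split; apply: val_inj. Qed.

Lemma det_mx22 (K : comNzRingType) (M : 'M[K]_2) :
  \det M = M 0 0 * M 1 1 - M 0 1 * M 1 0.
Proof.
rewrite (expand_det_row _ 0) big_ord_recl big_ord1 /cofactor !det_mx11 !mxE.
by rewrite !lift2 /= expr0 expr1 mul1r mulN1r mulrN.
Qed.

Section DetForms.
Context {R : realType}.
Variables (e : nat -> ambient R -> R) (T : ambient R -> Prop).
Implicit Types (s u w : seq nat) (L : seq (R * seq nat)).

(** This is the wedge product of the 1-forms [e] indexed by [s]. Indices missing from a list shorter
    than k would be read as 0, whence the conditions on [size s] below. *)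
Definition detform k s (v : 'I_k -> ambient R) : R :=
  \det (\matrix_(i < k, j < k) e (nth 0%N s i) (v j)).

Lemma detform1 m (v : 'I_1 -> ambient R) : detform [:: m] v = e m (v 0).
Proof. by rewrite /detform det_mx11 mxE. Qed.

Lemma detform2 m n (v : 'I_2 -> ambient R) :
  detform [:: m; n] v = e m (v 0) * e n (v 1) - e n (v 0) * e m (v 1).
Proof. by rewrite /detform det_mx22 !mxE /= [e m (v 1) * _]mulrC. Qed.

Lemma detform_swap k u a b w (v : 'I_k -> ambient R) :
  size (u ++ a :: b :: w) = k ->
  detform (u ++ a :: b :: w) v = - detform (u ++ b :: a :: w) v.
Proof.
rewrite size_cat /= => sk.
have i0k : (size u < k)%N by rewrite -sk -addSnnS leq_addr.
have i1k : ((size u).+1 < k)%N by rewrite -sk -2!addSnnS leq_addr.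
pose i0 := Ordinal i0k; pose i1 := Ordinal i1k.
have i01 : i0 != i1 by rewrite -val_eqE /= neq_ltn ltnSn.
transitivity (\det (row_perm (tperm i0 i1)
    (\matrix_(i < k, j < k) e (nth 0%N (u ++ b :: a :: w) i) (v j))));
    last first.
  by rewrite row_permE det_mulmx det_perm odd_tperm i01 expr1 mulN1r.
congr (\det _); apply/matrixP => i j; rewrite !mxE; congr (e _ _).
case: tpermP => [->|->|/eqP ne0 /eqP ne1] /=.
- by rewrite !nth_cat ltnn ltnNge leqnSn /= subnn subSnn.
- by rewrite !nth_cat ltnn ltnNge leqnSn /= subnn subSnn.
- rewrite !nth_cat; case: ltnP => // ui.
  move: ne0 ne1; rewrite -!val_eqE /= -(subnKC ui).
  case: (i - size u)%N => [|[|m]]; rewrite ?addn0 ?addn1 ?eqxx //.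
  by rewrite addKn.
Qed.

Lemma detform_repeat k s (v : 'I_k -> ambient R) :
  size s = k -> ~~ uniq s -> detform s v = 0.
Proof.
move=> sk /(uniqPn 0%N) [i [j [ij js eij]]].
have jk : (j < k)%N by rewrite -sk.
have ik : (i < k)%N := ltn_trans ij jk.
apply: (@determinant_alternate _ _ _ (Ordinal ik) (Ordinal jk)).
  by rewrite -val_eqE /= neq_ltn ij.
by move=> m; rewrite !mxE /= eij.
Qed.

(* On [T], eta is the combination with coefficients p.1 of the wedge products
   of the 1-forms [e] indexed by p.2. *)
Definition expands k (eta : ('I_k -> ambient R) -> R) L :=
  all (fun p => size p.2 == k) L /\
  forall v, (forall i, T (v i)) -> eta v = \sum_(p <- L) p.1 * detform p.2 v.

Lemma expandsD k (eta zeta : ('I_k -> ambient R) -> R) L L' :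
  expands eta L -> expands zeta L' ->
  expands (fun v => eta v + zeta v) (L ++ L').
Proof.
move=> [sL eL] [sL' eL']; split=> [|v Tv]; first by rewrite all_cat sL.
by rewrite big_cat eL // eL'.
Qed.

Lemma expandsZ k (eta : ('I_k -> ambient R) -> R) L c :
  expands eta L ->
  expands (fun v => c * eta v) [seq (c * p.1, p.2) | p <- L].
Proof.
move=> [sL eL]; split=> [|v Tv]; first by rewrite all_map.
by rewrite big_map eL // mulr_sumr; apply: eq_bigr => p _; rewrite mulrA.
Qed.

Lemma expandsB k (eta zeta : ('I_k -> ambient R) -> R) L L' :
  expands eta L -> expands zeta L' ->
  expands (fun v => eta v - zeta v) (L ++ [seq (-1 * p.1, p.2) | p <- L']).
Proof.
move=> eL eL'; rewrite (_ : (fun v => _) = fun v => eta v + -1 * zeta v).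
  by apply: expandsD => //; exact: expandsZ.
by apply/funext => v; rewrite mulN1r.
Qed.

(** By bilinearity only products of two determinants occur, and [det_col_mx_shuffle] turns the
    alternating sum of such products into one determinant with the rows of both. Its factor k! l!
    cancels the normalisation of [form_wedge]. *)
Lemma expands_wedge k l (eta : kform R k R) (zeta : kform R l R) x L L' :
  expands (eta x) L -> expands (zeta x) L' ->
  expands (rwedge eta zeta x)
    [seq (p.1 * q.1, p.2 ++ q.2) | p <- L, q <- L'].
Proof.
move=> [/allP sL eL] [/allP sL' eL']; split=> [|v Tv].
  apply/allP => _ /allpairsP [[p q] /= [/sL /eqP ps /sL' /eqP qs ->]] /=.
  by rewrite size_cat ps qs.
have -> : rwedge eta zeta x v = ((k`! * l`!)%N%:R)^-1 *
    \sum_(s : 'S_(k + l)) (-1) ^+ s *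
      (eta x (fun a => v (s (lshift l a))) *
       zeta x (fun b => v (s (rshift k b)))) by [].
under eq_bigr do rewrite eL // eL' // mulr_suml mulr_sumr.
rewrite exchange_big big_allpairs_dep mulr_sumr /=.
(* Membership in [L] is kept because the size of [p.2] decides where the second block of rows
   starts. *)
rewrite big_seq [RHS]big_seq; apply: eq_bigr => p /sL /eqP ps.
under eq_bigr do rewrite [p.1 * _ * _]mulr_sumr [_ ^+ _ * _]mulr_sumr.
rewrite exchange_big mulr_sumr /=.
rewrite big_seq [RHS]big_seq; apply: eq_bigr => q /sL' /eqP qs.
have -> : \sum_(s : 'S_(k + l)) (-1) ^+ s *
    (p.1 * detform p.2 (fun a => v (s (lshift l a))) *
    (q.1 * detform q.2 (fun b => v (s (rshift k b))))) =
  p.1 * q.1 * \sum_(s : 'S_(k + l)) (-1) ^+ s *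
    (detform p.2 (fun a => v (s (lshift l a))) *
     detform q.2 (fun b => v (s (rshift k b)))).
  rewrite [RHS]mulr_sumr; apply: eq_bigr => s _.
  by rewrite [_ * (q.1 * _)]mulrACA [LHS]mulrCA.
rewrite (det_col_mx_shuffle (fun i => e (nth 0%N p.2 i))
  (fun i => e (nth 0%N q.2 i))) mulrCA; congr (_ * _).
rewrite mulKf ?pnatr_eq0 -?lt0n ?muln_gt0 ?fact_gt0 //.
congr (\det _); apply/matrixP => i j; rewrite [RHS]mxE nth_cat ps.
case: (split_ordP i) => a ->; first by rewrite col_mxEu mxE.
by rewrite col_mxEd mxE /= addKn.
Qed.

End DetForms.

(** * Derivatives of the forms on the ambient space *)

Section Ambient.
Context {R : realType}.
Implicit Types (x u w v : ambient R) (C kappa : R) (a p q : quat R).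

Lemma qc_linear_continuous (V : normedModType R) (f : V -> quat R) l :
  linear f -> continuous f ->
  [/\ linear (fun y => qc l (f y)) & continuous (fun y => qc l (f y))].
Proof.
move=> linf cf; split; first by move=> c y z; rewrite linf qcD qcZ.
move=> y; apply: (@continuous_comp _ _ _ f (fun q : quat R => q 0 (inord l))).
  exact: cf.
exact: coord_continuous.
Qed.

Lemma qsmooth_linear (V : normedModType R) (f : V -> quat R) :
  linear f -> continuous f -> qsmooth f.
Proof.
move=> linf cf l; have [] := qc_linear_continuous l linf cf.
exact: smooth_linear.
Qed.

Lemma is_qderive_linear (V : normedModType R) (f : V -> quat R) (x v : V) :
  linear f -> continuous f -> is_qderive x v f (f v).
Proof.
move=> linf cf l; have [lc cc] := qc_linear_continuous l linf cf.
exact: is_derive_linear.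
Qed.

Lemma linear_slot1 : linear (fun x => x.1.1 : quat R). Proof. by []. Qed.
Lemma linear_slot2 : linear (fun x => x.1.2 : quat R). Proof. by []. Qed.
Lemma linear_slot3 : linear (fun x => x.2 : quat R). Proof. by []. Qed.

Lemma continuous_slot1 : continuous (fun x => x.1.1 : quat R).
Proof.
move=> x.
apply: (@continuous_comp _ _ _ (fun x => x.1) (fun y => y.1 : quat R));
  exact: cvg_fst.
Qed.

Lemma continuous_slot2 : continuous (fun x => x.1.2 : quat R).
Proof.
move=> x.
apply: (@continuous_comp _ _ _ (fun x => x.1) (fun y => y.2 : quat R)).
  exact: cvg_fst.
exact: cvg_snd.
Qed.

Lemma continuous_slot3 : continuous (fun x => x.2 : quat R).
Proof. move=> x; exact: cvg_snd. Qed.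

Lemma qsmooth_A1 v : qsmooth (fun x => A1 x v).
Proof.
have s1 := qsmooth_linear linear_slot1 continuous_slot1.
have s2 := qsmooth_linear linear_slot2 continuous_slot2.
have s3 := qsmooth_linear linear_slot3 continuous_slot3.
apply: qsmooth_im; apply: qsmoothM => //; apply: qsmooth_conj.
apply: qsmoothD; first exact: qsmooth_cst.
apply: qsmoothN; apply: qsmoothM => //.
apply: qsmoothZ; first exact: smooth_cst.
by apply: qsmoothD; apply: qsmoothM;
  (first [exact: qsmooth_cst | exact: qsmooth_conj]).
Qed.

Lemma smooth_rr : smooth (@rr R).
Proof.
have s3 := qsmooth_linear linear_slot3 continuous_slot3.
by apply: (qsmoothM s3 (qsmooth_conj s3)).
Qed.

Lemma is_derive_rr x v :
  is_derive x v (@rr R) (2 * qc 0 (qmul v.2 (qconj x.2))).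
Proof.
have D3 := is_qderive_linear x v linear_slot3 continuous_slot3.
apply: is_derive_eq (is_qderiveM D3 (is_qderive_conj D3) 0%N) _.
by rewrite /qconj !qcE; ring.
Qed.

(** The vector w is constant on the ambient space, so theta_i(w) = conj(g_i) w_i has derivative
    conj(u_i) w_i along u, and alpha(w) varies only through a phi(w). *)
Lemma is_qderive_A1 x u w : is_qderive x u (fun y => A1 y w)
  (qim (qmul x.2 (qconj (- (qmul x.2 (2^-1 *: (qmul (qconj u.1.1) w.1.1 +
     qmul (qconj u.1.2) w.1.2)) + qmul u.2 (phi x w)))) +
     qmul u.2 (qconj (alpha x w)))).
Proof.
have D1 := is_qderive_linear x u linear_slot1 continuous_slot1.
have D2 := is_qderive_linear x u linear_slot2 continuous_slot2.
have D3 := is_qderive_linear x u linear_slot3 continuous_slot3.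
apply: is_qderive_im; apply: is_qderiveM => //; apply: is_qderive_conj.
rewrite -[- _]add0r; apply: is_qderiveD; first exact: is_qderive_cst.
apply: is_qderiveN; apply: is_qderiveM => //.
have Dt : is_qderive x u (fun y => theta1 y w + theta2 y w)
    (qmul (qconj u.1.1) w.1.1 + qmul (qconj u.1.2) w.1.2).
  apply: is_qderiveD.
    have := is_qderiveM (is_qderive_conj D1) (is_qderive_cst x u w.1.1).
    by rewrite (_ : qmul _ 0 = 0) ?add0r //; qring.
  have := is_qderiveM (is_qderive_conj D2) (is_qderive_cst x u w.1.2).
  by rewrite (_ : qmul _ 0 = 0) ?add0r //; qring.
move=> l; have := is_qderiveZ (is_derive_cst (2^-1 : R) x u) Dt l.
by rewrite scale0r addr0.
Qed.

End Ambient.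

(** * The profile function and its differential equation *)

Section InstantonFunction.
Context {R : realType}.
Implicit Types (x u v : ambient R) (C t r : R).

(** In terms of the cube root s, all the powers that occur become rational functions of s, which
    [field] can compare. *)
Lemma powR_third t : 0 < t ->
  [/\ 0 < t `^ (1 / 3), t = (t `^ (1 / 3)) ^+ 3
    & t `^ (- (2 / 3)) = (t `^ (1 / 3)) ^- 2].
Proof.
move=> t0; split; first exact: powR_gt0.
  rewrite -powR_mulrn ?powR_ge0 // -powRrM (_ : 1 / 3 * 3%:R = 1).
    by rewrite powRr1 // ltW.
  by field.
rewrite -powR_invn ?powR_ge0 // -powRrM; congr (_ `^ _); by field.
Qed.

Lemma rr_ge0 x : 0 <= rr x.
Proof. exact: qnorm2_ge0. Qed.

Lemma rr1_gt0 x : 0 < rr x + 1.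
Proof. by rewrite ltr_wpDl // rr_ge0. Qed.

(** With s = (r + 1)^(1/3) >= 1 the denominator is s (3 s^2 + C), and 3 s^2 + C >= 3 + C > 0. *)
Lemma ff_den_gt0 C r : -3 < C -> 0 <= r ->
  0 < 3 * (r + 1) + C * (r + 1) `^ (1 / 3).
Proof.
move=> hC r0; have t0 : 0 < r + 1 by rewrite ltr_wpDl.
have [s0 ts _] := powR_third t0.
have s1 : 1 <= (r + 1) `^ (1 / 3).
  rewrite -[leLHS](powRr0 (r + 1)); apply: ler_powR; first by rewrite lerDr.
  by rewrite divr_ge0.
rewrite {1}ts; set s := _ `^ _ in s0 s1 *.
rewrite (_ : _ + _ = s * (3 * s ^+ 2 + C)); last by ring.
by rewrite mulr_gt0 //; nra.
Qed.

Lemma smooth_ff_den C :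
  smooth (fun x : ambient R => 3 * (rr x + 1) + C * (rr x + 1) `^ (1 / 3)).
Proof.
have s1 : smooth (fun x : ambient R => rr x + 1).
  by apply: smoothD; [exact: smooth_rr | exact: smooth_cst].
apply: smoothD; apply: smoothM => //; try exact: smooth_cst.
by apply: smooth_powR => // x; exact: rr1_gt0.
Qed.

(** Written as a power, the quotient falls under the same chain rule as the cube root in its
    denominator. *)
Lemma ff_powR C x : - 3 < C -> ff C (rr x) =
  2 * (3 * (rr x + 1) + C * (rr x + 1) `^ (1 / 3)) `^ (- 1).
Proof. by move=> hC; rewrite powR_inv1 // ltW // ff_den_gt0 // rr_ge0. Qed.

Lemma smooth_ff C : - 3 < C -> smooth (fun x : ambient R => ff C (rr x)).
Proof.
move=> hC; under eq_fun do rewrite ff_powR //.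
apply: smoothM; first exact: smooth_cst.
apply: smooth_powR; last exact: smooth_ff_den.
by move=> x; rewrite ff_den_gt0 // rr_ge0.
Qed.

(** The number f' is hidden behind an existential: the curvature computation uses only the chain
    rule, and the instanton equation only the value of f' + f^2. *)
Lemma is_derive_ff C x : - 3 < C -> exists f' : R,
  f' + ff C (rr x) ^+ 2 = - ff C (rr x) / (3 * (1 + rr x)) /\
  forall v, is_derive x v (fun y => ff C (rr y))
    (f' * (2 * qc 0 (qmul v.2 (qconj x.2)))).
Proof.
move=> hC; pose d := 3 * (rr x + 1) + C * (rr x + 1) `^ (1 / 3).
have d0 : 0 < d by rewrite ff_den_gt0 // rr_ge0.
(* This is - 2 d' / d^2, in the shape produced by the power rule applied to f = 2 d^(-1). *)
exists (2 * (- 1 * d `^ (- 1 - 1) *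
  (3 + C * (1 / 3 * (rr x + 1) `^ (1 / 3 - 1))))); split.
  have [s0 ts e2] := powR_third (rr1_gt0 x).
  rewrite (_ : 1 / 3 - 1 = - (2 / 3)) ?e2; last by field.
  rewrite (_ : d `^ (- 1 - 1) = d ^- 2); last first.
    by rewrite -powR_invn ?(ltW d0) //; congr (_ `^ _); ring.
  rewrite /ff -/d; move: d0; rewrite [1 + _]addrC /d.
  set s := _ `^ _ in s0 ts *; rewrite ts => d0.
  have dE : 3 * s ^+ 3 + C * s = s * (3 * s ^+ 2 + C) by ring.
  have k0 : 3 * s ^+ 2 + C != 0.
    by move: d0; rewrite dE pmulr_rgt0 // => /gt_eqF ->.
  by rewrite dE; field; rewrite k0 gt_eqF.
move=> v; under eq_fun do rewrite ff_powR //.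
pose t (y : ambient R) := rr y + 1.
have Dt : is_derive x v t (2 * qc 0 (qmul v.2 (qconj x.2))).
  rewrite -[X in is_derive _ _ _ X]addr0.
  exact: (@is_deriveD _ _ _ _ _ _ _ _ _
    (is_derive_rr x v) (is_derive_cst _ _ _)).
have st : smooth t by apply: smoothD; [exact: smooth_rr | exact: smooth_cst].
have Ds :=
  is_derive_powR_comp (1 / 3) v (smooth_differentiable x st) (rr1_gt0 x).
have Dd := @is_deriveD _ _ _ _ _ _ _ _ _
  (@is_deriveM _ _ _ _ _ _ _ _ (is_derive_cst (3 : R) x v) Dt)
  (@is_deriveM _ _ _ _ _ _ _ _ (is_derive_cst C x v) Ds).
have Dp :=
  is_derive_powR_comp (- 1) v (smooth_differentiable x (smooth_ff_den C)) d0.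
eapply is_derive_eq.
  exact: (@is_deriveM _ _ _ _ _ _ _ _ (is_derive_cst (2 : R) x v) Dp).
rewrite !scaler0 !addr0.
have [_ ->] := Dd; have [_ ->] := Dt; rewrite !scaler0 !addr0.
rewrite /GRing.scale /=; ring.
Qed.

End InstantonFunction.

(** * Curvature *)

Section CurvatureIdentities.
Context {R : realType}.
Implicit Types (x u w : ambient R) (C kappa f : R) (a p q : quat R).

(* On tangent vectors of P the curvature is horizontal, and splits as
   [curv_alpha], of type alpha /\ alpha, plus [curv_omega], of type
   omega /\ omega; [f'] stands for the derivative of f at r, and
   dr = 2 Re (alpha \bar a). *)
Definition curv_alpha a f (f' : R) p q : quat R :=
  f' *: ((2 * qc 0 (qmul p (qconj a))) *: qim (qmul a (qconj q)) -
         (2 * qc 0 (qmul q (qconj a))) *: qim (qmul a (qconj p))) +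
  f *: (qmul p (qconj q) - qmul q (qconj p)) +
  f ^+ 2 *: (qmul (qim (qmul a (qconj p))) (qim (qmul a (qconj q))) -
             qmul (qim (qmul a (qconj q))) (qim (qmul a (qconj p)))).

(** The commutator of two values of omega is a value of omega /\ omega = 2 Omega, hence kappa / 4
    where the formula in Omega has kappa / 2. *)
Definition curv_omega kappa a f p q : quat R :=
  - (kappa / 4 * f) *: qmul (qmul a (qmul p q - qmul q p)) (qconj a).

Definition qconjE := (@qconjN R, @qconjD R, @qconjZ R, @qconjM R, @qconjK R).

Definition qmulE := (@qmulDl R, @qmulDr R, @qmulNl R, @qmulNr R,
  @qmulZl R, @qmulZr R, @qmulA R).

Lemma qim_conjE p : qim p = 2^-1 *: (p - qconj p).
Proof. by apply: qext; rewrite /qim /qconj !qcE; field. Qed.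

(** Writing p = g s and q = g t with s imaginary, conj(p) q = conj(s) t = - s t. This is the source
    of the Maurer-Cartan equation d theta = - theta /\ theta on P. *)
Lemma conj_mul_theta (g p q : quat R) :
  in_SU2 g -> imaginary (qmul (qconj g) p) ->
  qmul (qconj p) q = - qmul (qmul (qconj g) p) (qmul (qconj g) q).
Proof.
move=> g1 /imaginary_conj gp; rewrite -qmulNl -gp qconjM qconjK qmulA.
by rewrite -[qmul (qmul _ g) _]qmulA SU2_mulqV // qmul1r.
Qed.

(** Unlike [qext], this leaves the component abstract: with products opaque, [ring] and [field]
    treat the component of each noncommutative monomial as an atom, and no real coordinates
    appear. *)
Lemma qextl p q : (forall l, qc l p = qc l q) -> p = q.
Proof. by move=> pq; apply: qext. Qed.

Opaque qmul qconj qim.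

(* The Maurer-Cartan equations of both factors enter as [- qmul s s'] and
   [- qmul t t'], where (s, t) and (s', t') are the values of
   (theta_1, theta_2) on two tangent vectors; [P] and [Q] are the H-components
   of these vectors. *)
Lemma dA1_identity (a p q s t s' t' : quat R) :
  imaginary s -> imaginary t -> imaginary s' -> imaginary t' ->
  let P := p + qmul a (2^-1 *: (s + t)) in
  let Q := q + qmul a (2^-1 *: (s' + t')) in
  qim (qmul a (qconj (- (qmul a (2^-1 *: (- qmul s s' - qmul t t')) +
                         qmul P (2^-1 *: (s' + t'))))) +
       qmul P (qconj q)) -
  qim (qmul a (qconj (- (qmul a (2^-1 *: (- qmul s' s - qmul t' t)) +
                         qmul Q (2^-1 *: (s + t))))) +
       qmul Q (qconj p)) =
  qmul p (qconj q) - qmul q (qconj p) -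
  4^-1 *: qmul (qmul a (qmul (s - t) (s' - t') - qmul (s' - t') (s - t)))
            (qconj a).
Proof.
cbv zeta => s0 t0 s0' t0'; rewrite !qim_conjE.
rewrite !(qconjE, imaginary_conj s0, imaginary_conj t0,
    imaginary_conj s0', imaginary_conj t0').
rewrite !qmulE; apply: qextl => l; rewrite !(qcD, qcN, qcZ).
by field.
Qed.

End CurvatureIdentities.

Lemma sum_S2 (V : nmodType) (F : 'S_2 -> V) :
  \sum_(s : 'S_2) F s = F 1%g + F (tperm 0 1).
Proof.
have ne : tperm 0 1 != 1%g :> 'S_2.
  by apply/eqP => /permP /(_ 0); rewrite tpermL perm1.
rewrite (bigD1 1%g) //= (bigD1 (tperm 0 1)) //= big1 ?addr0 // => s.
case/andP => s1 st; case/negP: st; apply/eqP/permP => i.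
have s10 : s 1 != s 0 by rewrite (inj_eq perm_inj).
have [s00|s01] := ord2P (s 0).
  case/eqP: s1; apply/permP => j; rewrite perm1; case: (ord2P j) => -> //.
  by case: (ord2P (s 1)) => // e; rewrite s00 e in s10.
case: (ord2P i) => ->; first by rewrite tpermL.
by rewrite tpermR; case: (ord2P (s 1)) => // e; rewrite s01 e in s10.
Qed.

Section Curvature.
Context {R : realType}.
Implicit Types (x u w : ambient R) (C kappa f : R) (a p q : quat R).

Lemma cmx_wedge11 (A : kform R 1 'M[R[i]]_2) x (v : 'I_2 -> ambient R) :
  cmx_wedge A A x v = A x (fun=> v 0) *m A x (fun=> v 1) -
                      A x (fun=> v 1) *m A x (fun=> v 0).
Proof.
have l0 (s : 'S_(1 + 1)) :
    (fun i : 'I_1 => v (s (lshift 1 i))) = fun=> v (s (0 : 'I_2)).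
  by apply/funext => i; congr (v (s _)); rewrite (ord1 i); apply: val_inj.
have r0 (s : 'S_(1 + 1)) :
    (fun i : 'I_1 => v (s (rshift 1 i))) = fun=> v (s (1 : 'I_2)).
  by apply/funext => i; congr (v (s _)); rewrite (ord1 i); apply: val_inj.
rewrite /cmx_wedge /form_wedge; under eq_bigr do rewrite l0 r0.
rewrite (sum_S2 (fun s : 'S_(1 + 1) => _)) odd_tperm odd_perm1 /=.
by rewrite !perm1 tpermL tpermR expr0 expr1 invr1 !scale1r scaleN1r.
Qed.

Lemma ext_d1 (A : kform R 1 'M[R[i]]_2) x (v : 'I_2 -> ambient R) :
  ext_d A x v = derive_cmx (fun y => A y (fun=> v 1)) x (v 0) -
                derive_cmx (fun y => A y (fun=> v 0)) x (v 1).
Proof.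
rewrite /ext_d big_ord_recl big_ord1 /= expr0 expr1 scale1r scaleN1r.
have -> : (fun y => A y (fun j => v (lift 0 j))) = fun y => A y (fun=> v 1).
  apply/funext => y; congr (A y _).
  by apply/funext => j; rewrite (ord1 j) lift2.
have -> : lift ord0 ord0 = 1 :> 'I_2 by apply: val_inj.
have -> // : (fun y => A y (fun j => v (lift 1 j))) = fun y => A y (fun=> v 0).
by apply/funext => y; congr (A y _); apply/funext => j; rewrite (ord1 j) lift2.
Qed.

Lemma slot3E x u : u.2 = alpha x u + qmul x.2 (phi x u).
Proof. by rewrite /alpha subrK. Qed.

(** The two sides differ by Re(a phi conj(a)), which is 0 since phi is imaginary on tangent vectors.
    Hence dr = 2 Re(alpha conj(a)). *)
Lemma qc0_slot3 x u : tangent_P x u ->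
  qc 0 (qmul u.2 (qconj x.2)) = qc 0 (qmul (alpha x u) (qconj x.2)).
Proof.
move=> [t1 t2]; rewrite [in LHS](slot3E x) qmulDl qcD -[RHS]addr0.
congr (_ + _); rewrite /phi; move: t1 t2; rewrite -/(theta1 x u) -/(theta2 x u).
move: (theta1 x u) (theta2 x u) => s t; rewrite /imaginary => s0 t0.
by rewrite /qconj !qcE s0 t0; ring.
Qed.

Lemma conj_theta1 x u w : in_P x -> tangent_P x u ->
  qmul (qconj u.1.1) w.1.1 = - qmul (theta1 x u) (theta1 x w).
Proof. by move=> [x1 _] [t1 _]; exact: conj_mul_theta. Qed.

Lemma conj_theta2 x u w : in_P x -> tangent_P x u ->
  qmul (qconj u.1.2) w.1.2 = - qmul (theta2 x u) (theta2 x w).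
Proof. by move=> [_ x2] [_ t2]; exact: conj_mul_theta. Qed.

(** Only the derivative along u of A_1(w), as in [is_qderive_A1]; the exterior derivative is its
    antisymmetrisation in u and w. *)
Definition dA1 x u w : quat R :=
  qim (qmul x.2 (qconj (- (qmul x.2 (2^-1 *: (qmul (qconj u.1.1) w.1.1 +
     qmul (qconj u.1.2) w.1.2)) + qmul u.2 (phi x w)))) +
     qmul u.2 (qconj (alpha x w))).

#[local] Opaque qmul qconj qim.

(** All terms in phi cancel against the Maurer-Cartan terms. The factor kappa appears because
    theta_1 - theta_2 is kappa^(1/2) omega. *)
Lemma dA1E kappa x u w :
  0 < kappa -> in_P x -> tangent_P x u -> tangent_P x w ->
  dA1 x u w - dA1 x w u =
  qmul (alpha x u) (qconj (alpha x w)) - qmul (alpha x w) (qconj (alpha x u)) -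
  (kappa / 4) *: qmul (qmul x.2 (qmul (omega kappa x u) (omega kappa x w) -
    qmul (omega kappa x w) (omega kappa x u))) (qconj x.2).
Proof.
move=> k0 xP uT wT; rewrite /dA1 !(conj_theta1 _ xP uT) !(conj_theta2 _ xP uT).
rewrite !(conj_theta1 _ xP wT) !(conj_theta2 _ xP wT) (slot3E x u) (slot3E x w).
have [s0 t0] := uT; have [s0' t0'] := wT.
rewrite /phi; etransitivity; first exact: (dA1_identity _ _ _ s0 t0 s0' t0').
rewrite -/(theta1 x u) -/(theta2 x u) -/(theta1 x w) -/(theta2 x w).
congr (_ - _); rewrite /omega !qmulZl !qmulZr !scalerA -scalerBr qmulZr qmulZl.
rewrite scalerA; congr (_ *: _).
rewrite mulrAC -!powRD ?(gt_eqF k0) ?implybT // (_ : - 2^-1 - 2^-1 = - 1).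
  by rewrite powR_inv1 ?(ltW k0) // mulfV ?mul1r // gt_eqF.
by field.
Qed.

Lemma curvature_collect (f f' r0 r1 k : R) (X Y Z W p q : quat R) :
  X - Y = Z - k *: W ->
  f *: X + (f' * r0) *: q - (f *: Y + (f' * r1) *: p) +
    (qmul (f *: p) (f *: q) - qmul (f *: q) (f *: p)) =
  f' *: (r0 *: q - r1 *: p) + f *: Z +
    f ^+ 2 *: (qmul p q - qmul q p) + - (k * f) *: W.
Proof.
move=> /eqP; rewrite subr_eq => /eqP ->; rewrite !qmulZl !qmulZr.
by apply: qextl => l; rewrite !(qcD, qcN, qcZ); ring.
Qed.

Lemma std_rep_curvature (p q p' q' : quat R) :
  std_rep p - std_rep q +
    (std_rep p' *m std_rep q' - std_rep q' *m std_rep p') =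
  std_rep (p - q + (qmul p' q' - qmul q' p')).
Proof. by rewrite -!std_repM -!std_repN -!std_repD. Qed.

Lemma curvatureE C kappa x (v : 'I_2 -> ambient R) (f' : R) :
  0 < kappa ->
  (forall v, is_derive x v (fun y => ff C (rr y))
    (f' * (2 * qc 0 (qmul v.2 (qconj x.2))))) ->
  in_P x -> (forall i, tangent_P x (v i)) ->
  curvature (instanton_form C) x v =
  std_rep (curv_alpha x.2 (ff C (rr x)) f' (alpha x (v 0)) (alpha x (v 1)) +
    curv_omega kappa x.2 (ff C (rr x))
      (omega kappa x (v 0)) (omega kappa x (v 1))).
Proof.
move=> k0 Df xP Tv; set f := ff C (rr x); set a := x.2.
have D u w : derive_cmx (fun y => instanton_form C y (fun=> w)) x u =
    std_rep (f *: dA1 x u w + (f' * (2 * qc 0 (qmul u.2 (qconj a)))) *: A1 x w).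
  exact: (derive_cmx_std_rep (is_qderiveZ (Df u) (is_qderive_A1 x u w))).
rewrite /curvature ext_d1 cmx_wedge11 (D (v 0) (v 1)) (D (v 1) (v 0)).
rewrite (std_rep_curvature _ _ (f *: A1 x (v 0)) (f *: A1 x (v 1))).
congr std_rep; rewrite (qc0_slot3 (Tv 0)) (qc0_slot3 (Tv 1)).
exact/curvature_collect/dA1E.
Qed.

End Curvature.

(** * The instanton equation *)

Section SortedDet.
Context {R : realType}.
Variables (e : nat -> ambient R -> R).
Implicit Types (s u w : seq nat).

(** One step of insertion sort, with the parity of the adjacent swaps it makes. On concrete lists it
    is evaluated by computation. *)
Fixpoint insert_sign (m : nat) s : bool * seq nat :=
  if s is n :: w then
    if (m <= n)%N then (false, m :: s)
    else let: (b, w') := insert_sign m w in (~~ b, n :: w')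
  else (false, [:: m]).

Fixpoint sort_sign s : bool * seq nat :=
  if s is m :: w then
    let: (b, w') := sort_sign w in let: (c, w'') := insert_sign m w' in
    (b (+) c, w'')
  else (false, [::]).

Lemma size_insert_sign m s : size (insert_sign m s).2 = (size s).+1.
Proof.
elim: s => //= n s; case: leqP => // _.
by case: (insert_sign m s) => b w /= ->.
Qed.

Lemma size_sort_sign s : size (sort_sign s).2 = size s.
Proof.
elim: s => //= m s; case: (sort_sign s) => b w /= <-.
by have := size_insert_sign m w; case: insert_sign.
Qed.

(** The prefix [u] is general so that it can absorb each index that m has moved past; every such
    move is one [detform_swap]. *)
Lemma detform_insert k u m s (v : 'I_k -> ambient R) : size (u ++ m :: s) = k ->
  detform e (u ++ m :: s) v =
  (-1) ^+ (insert_sign m s).1 * detform e (u ++ (insert_sign m s).2) v.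
Proof.
elim: s u => [|n s IH] u /= sk; first by rewrite mul1r.
case: leqP => _; first by rewrite mul1r.
have {IH} := IH (rcons u n).
rewrite !cat_rcons !size_cat /= in sk *; move=> /(_ sk).
case: insert_sign => b w /= E; rewrite detform_swap ?size_cat // E.
by rewrite signrN mulNr.
Qed.

Lemma detform_sort k s (v : 'I_k -> ambient R) : size s = k ->
  detform e s v = (-1) ^+ (sort_sign s).1 * detform e (sort_sign s).2 v.
Proof.
suff H u : size (u ++ s) = k -> detform e (u ++ s) v =
    (-1) ^+ (sort_sign s).1 * detform e (u ++ (sort_sign s).2) v.
  exact: (H [::]).
elim: s u => [|m s IH] u /= sk; first by rewrite mul1r.
have := IH (rcons u m); rewrite !cat_rcons => /(_ sk) ->.
have := size_sort_sign s; case: sort_sign => b w /= sw.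
rewrite detform_insert; last by rewrite -sk !size_cat /= sw.
by case: insert_sign => c w' /=; rewrite signr_addb mulrA.
Qed.

End SortedDet.

Section WedgeStdRep.
Context {R : realType}.
Implicit Types (x u w : ambient R) (C kappa f : R) (a p q : quat R).

(** By real linearity [std_rep] comes out of the sum over permutations. The remaining quaternion
    vanishes as soon as its components do, and these are wedges of real forms, to which
    [expands_wedge] applies. *)
Lemma cmx_rwedge_std_rep k l (eta : kform R k 'M[R[i]]_2) (zeta : kform R l R) x
    (T : ambient R -> Prop) (F : ('I_k -> ambient R) -> quat R) v :
  (forall v, (forall i, T (v i)) -> eta x v = std_rep (F v)) ->
  (forall i, T (v i)) ->
  (forall m, rwedge (fun _ v => qc m (F v)) zeta x v = 0) ->
  cmx_rwedge eta zeta x v = 0.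
Proof.
move=> etaF Tv F0; rewrite -std_rep0.
pose Q : quat R := ((k`! * l`!)%N%:R)^-1 *: \sum_(s : 'S_(k + l)) (-1) ^+ s *:
  (zeta x (fun b => v (s (rshift k b))) *: F (fun i => v (s (lshift l i)))).
have -> : cmx_rwedge eta zeta x v = std_rep Q.
  rewrite /Q std_repZ (big_morph _ (@std_repD R) (@std_rep0 R)).
  rewrite /cmx_rwedge /form_wedge; congr (_ *: _).
    by rewrite -[Complex _ _]/(real_complex R _) fmorphV rmorph_nat.
  apply: eq_bigr => s _; rewrite etaF // !std_repZ; congr (_ *: _).
  by rewrite -[Complex _ _]/(real_complex R _) rmorph_sign.
congr std_rep; apply: qextl => m; rewrite qc_zero -(F0 m) /rwedge /form_wedge.
rewrite /Q qcZ; congr (_ * _).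
rewrite (big_morph _ (qcD m) (qc_zero m)); apply: eq_bigr => s _.
by rewrite !qcZ [zeta _ _ * _]mulrC.
Qed.

Definition qe (m : nat) : quat R :=
  qmk (m == 0)%:R (m == 1)%:R (m == 2)%:R (m == 3)%:R.

(* Indices 0, 1, 2 stand for omega^1, omega^2, omega^3, and 3, 4, 5, 6 for
   alpha^0, ..., alpha^3. *)
Definition coframe kappa x (m : nat) u : R :=
  if (m < 3)%N then qc m.+1 (omega kappa x u) else qc (m - 3) (alpha x u).

End WedgeStdRep.

Section CoordinateQuaternions.
Context {R : realType}.
Implicit Type p : quat R.

Lemma qmk_eta p : p = qmk (qc 0 p) (qc 1 p) (qc 2 p) (qc 3 p).
Proof. by apply: qext; rewrite qc_mk. Qed.

Lemma qmkD (a0 a1 a2 a3 b0 b1 b2 b3 : R) :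
  qmk a0 a1 a2 a3 + qmk b0 b1 b2 b3 =
  qmk (a0 + b0) (a1 + b1) (a2 + b2) (a3 + b3).
Proof. by apply: qext; rewrite qcD !qc_mk. Qed.

Lemma qmkN (a0 a1 a2 a3 : R) :
  - qmk a0 a1 a2 a3 = qmk (- a0) (- a1) (- a2) (- a3).
Proof. by apply: qext; rewrite qcN !qc_mk. Qed.

Lemma qmkZ (c a0 a1 a2 a3 : R) :
  c *: qmk a0 a1 a2 a3 = qmk (c * a0) (c * a1) (c * a2) (c * a3).
Proof. by apply: qext; rewrite qcZ !qc_mk. Qed.

Lemma qmkM (a0 a1 a2 a3 b0 b1 b2 b3 : R) :
  qmul (qmk a0 a1 a2 a3) (qmk b0 b1 b2 b3) =
  qmk (a0 * b0 - a1 * b1 - a2 * b2 - a3 * b3)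
      (a0 * b1 + a1 * b0 + a2 * b3 - a3 * b2)
      (a0 * b2 - a1 * b3 + a2 * b0 + a3 * b1)
      (a0 * b3 + a1 * b2 - a2 * b1 + a3 * b0).
Proof. by rewrite /qmul !qc_mk. Qed.

Lemma qmk_conj (a0 a1 a2 a3 : R) :
  qconj (qmk a0 a1 a2 a3) = qmk a0 (- a1) (- a2) (- a3).
Proof. by rewrite /qconj !qc_mk. Qed.

Lemma qmk_im (a0 a1 a2 a3 : R) : qim (qmk a0 a1 a2 a3) = qmk 0 a1 a2 a3.
Proof. by rewrite /qim !qc_mk. Qed.

End CoordinateQuaternions.

Ltac qmk_norm :=
  repeat rewrite ?qmk_conj ?qmkM ?qmk_im ?qmkN ?qmkD ?qmkZ ?qc_mk.

Section InstantonAlgebra.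
Context {R : realType}.
Implicit Types (kappa f : R) (a p q : quat R).

#[local] Opaque qmul qmk qc.
(* alpha /\ \bar alpha is self-dual, so f enters only through f' + f^2. *)
Lemma curv_alpha_asd a f (f' : R) :
  let g := 2 * (f' + f ^+ 2) in
  [/\ curv_alpha a f f' (qe 2) (qe 3) - curv_alpha a f f' (qe 0) (qe 1) =
      g *: qmul (qmul a (qe 1)) (qconj a),
      curv_alpha a f f' (qe 3) (qe 1) - curv_alpha a f f' (qe 0) (qe 2) =
      g *: qmul (qmul a (qe 2)) (qconj a)
    & curv_alpha a f f' (qe 1) (qe 2) - curv_alpha a f f' (qe 0) (qe 3) =
      g *: qmul (qmul a (qe 3)) (qconj a)].
Proof.
by cbv zeta; rewrite (qmk_eta a); split; rewrite /curv_alpha /qe /=;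
  qmk_norm; congr qmk; ring.
Qed.

(** The commutator of e_2 and e_3 is 2 e_1, and cyclically. The quaternions a e_i conj(a) are those
    of [curv_alpha_asd], so that one scalar equation will settle all three directions. *)
Lemma curv_omega_basis kappa a f : let g := - (kappa / 2 * f) in
  [/\ curv_omega kappa a f (qe 2) (qe 3) = g *: qmul (qmul a (qe 1)) (qconj a),
      curv_omega kappa a f (qe 3) (qe 1) = g *: qmul (qmul a (qe 2)) (qconj a)
    & curv_omega kappa a f (qe 1) (qe 2) = g *: qmul (qmul a (qe 3)) (qconj a)].
Proof.
by cbv zeta; rewrite (qmk_eta a); split; rewrite /curv_omega /qe /=;
  qmk_norm; congr qmk; field.
Qed.

End InstantonAlgebra.

Section InstantonExpand.
Context {R : realType}.
Implicit Types (kappa f : R) (a p q : quat R).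

(** The nesting and the final 0 fit [linear], which is stated for c *: u + w. *)
Lemma qe_decomp p : p = qc 0 p *: qe 0 + (qc 1 p *: qe 1 +
  (qc 2 p *: qe 2 + (qc 3 p *: qe 3 + 0))).
Proof. by apply: qext; rewrite /qe !qcE /=; ring. Qed.

(** Linearity on the right follows from antisymmetry. The pair (3, 1) is kept in cyclic order to
    match B^2 and omega^31. *)
Lemma alternating_expand (T : quat R -> quat R -> quat R) p q :
  (forall r, linear (T^~ r)) -> (forall r s, T r s = - T s r) ->
  T p q =
  (qc 0 p * qc 1 q - qc 1 p * qc 0 q) *: T (qe 0) (qe 1) +
  (qc 0 p * qc 2 q - qc 2 p * qc 0 q) *: T (qe 0) (qe 2) +
  (qc 0 p * qc 3 q - qc 3 p * qc 0 q) *: T (qe 0) (qe 3) +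
  (qc 1 p * qc 2 q - qc 2 p * qc 1 q) *: T (qe 1) (qe 2) +
  (qc 3 p * qc 1 q - qc 1 p * qc 3 q) *: T (qe 3) (qe 1) +
  (qc 2 p * qc 3 q - qc 3 p * qc 2 q) *: T (qe 2) (qe 3).
Proof.
move=> linT altT.
have T0 r : T 0 r = 0.
  by have := linT r (-1) 0 0; rewrite scaler0 addr0 scaleN1r addNr.
have Tl p' r : T p' r = qc 0 p' *: T (qe 0) r + (qc 1 p' *: T (qe 1) r +
    (qc 2 p' *: T (qe 2) r + qc 3 p' *: T (qe 3) r)).
  by rewrite {1}(qe_decomp p') !linT T0 addr0.
(* Antisymmetry gives 2 T(r, r) = 0, and 2 is invertible. *)
have Trr r : T r r = 0.
  apply: qextl => l; have /(congr1 (qc l)) := altT r r.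
  rewrite qcN qc_zero => e; apply: (@mulIf _ 2) => //.
  by rewrite mul0r mulrDr !mulr1 {1}e addNr.
rewrite (Tl p) !(altT _ q) !(Tl q) !Trr.
rewrite (altT (qe 1) (qe 0)) (altT (qe 2) (qe 0)) (altT (qe 3) (qe 0)).
rewrite (altT (qe 2) (qe 1)) (altT (qe 3) (qe 2)) (altT (qe 1) (qe 3)).
by apply: qextl => l; rewrite !(qcD, qcN, qcZ, qc_zero); ring.
Qed.

#[local] Opaque qmul qconj qim.

Lemma qimD p q : qim (p + q) = qim p + qim q.
Proof. by rewrite !qim_conjE qconjD -scalerDr opprD addrACA. Qed.

Lemma qimZ (c : R) p : qim (c *: p) = c *: qim p.
Proof. by rewrite !qim_conjE qconjZ -scalerBr !scalerA mulrC. Qed.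

Lemma curv_alpha_expand a f (f' : R) p q :
  curv_alpha a f f' p q =
  (qc 0 p * qc 1 q - qc 1 p * qc 0 q) *: curv_alpha a f f' (qe 0) (qe 1) +
  (qc 0 p * qc 2 q - qc 2 p * qc 0 q) *: curv_alpha a f f' (qe 0) (qe 2) +
  (qc 0 p * qc 3 q - qc 3 p * qc 0 q) *: curv_alpha a f f' (qe 0) (qe 3) +
  (qc 1 p * qc 2 q - qc 2 p * qc 1 q) *: curv_alpha a f f' (qe 1) (qe 2) +
  (qc 3 p * qc 1 q - qc 1 p * qc 3 q) *: curv_alpha a f f' (qe 3) (qe 1) +
  (qc 2 p * qc 3 q - qc 3 p * qc 2 q) *: curv_alpha a f f' (qe 2) (qe 3).
Proof.
apply: alternating_expand => [r c u v|r s]; apply: qextl => l.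
  rewrite /curv_alpha !(qimD, qimZ, qconjE, @qmulE R).
  by rewrite !(qcD, qcN, qcZ, qimD, qimZ); ring.
by rewrite /curv_alpha !(qcD, qcN, qcZ); ring.
Qed.

Lemma curv_omega_expand kappa a f p q : imaginary p -> imaginary q ->
  curv_omega kappa a f p q =
  (qc 1 p * qc 2 q - qc 2 p * qc 1 q) *: curv_omega kappa a f (qe 1) (qe 2) +
  (qc 3 p * qc 1 q - qc 1 p * qc 3 q) *: curv_omega kappa a f (qe 3) (qe 1) +
  (qc 2 p * qc 3 q - qc 3 p * qc 2 q) *: curv_omega kappa a f (qe 2) (qe 3).
Proof.
rewrite /imaginary => p0 q0.
rewrite [LHS](@alternating_expand (curv_omega kappa a f)) => [|r c u v|r s].
- by rewrite p0 q0 !(mul0r, mulr0) subr0 !scale0r !add0r.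
- apply: qextl => l.
  rewrite /curv_omega !(@qmulE R).
  by rewrite !(qcD, qcN, qcZ); ring.
apply: qextl => l; rewrite /curv_omega !(@qmulE R).
by rewrite !(qcD, qcN, qcZ); ring.
Qed.


End InstantonExpand.

Section FormExpansions.
Context {R : realType}.
Implicit Types (x u w : ambient R) (C kappa f : R) (a p q : quat R).

Lemma omega_imaginary kappa x u : tangent_P x u -> imaginary (omega kappa x u).
Proof.
move=> [t1 t2]; rewrite /imaginary /omega qcZ qcD qcN.
by rewrite [qc 0 (theta1 x u)]t1 [qc 0 (theta2 x u)]t2 subr0 mulr0.
Qed.

Lemma expands_omega_ kappa x T i : (i < 3)%N ->
  expands (coframe kappa x) T (omega_ kappa i.+1 x) [:: (1, [:: i])].
Proof.
move=> i3; split=> // v _; rewrite big_seq1 /= detform1 mul1r /coframe i3.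
by [].
Qed.

Lemma expands_alpha_ kappa x T i :
  expands (coframe kappa x) T (alpha_ i x) [:: (1, [:: i.+3])].
Proof.
split=> // v _; rewrite big_seq1 /= detform1 mul1r /coframe /=.
by rewrite subSS subSS subSS subn0.
Qed.

(** There is no mixed alpha /\ omega pair. Tangency makes omega imaginary, which leaves three omega
    pairs beside the six alpha pairs. *)
Lemma expands_curvature kappa x a f (f' : R) l :
  expands (coframe kappa x) (tangent_P x)
    (fun v : 'I_2 -> ambient R => qc l
      (curv_alpha a f f' (alpha x (v 0)) (alpha x (v 1)) +
       curv_omega kappa a f (omega kappa x (v 0)) (omega kappa x (v 1))))
    [:: (qc l (curv_alpha a f f' (qe 0) (qe 1)), [:: 3; 4]%N);
        (qc l (curv_alpha a f f' (qe 0) (qe 2)), [:: 3; 5]%N);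
        (qc l (curv_alpha a f f' (qe 0) (qe 3)), [:: 3; 6]%N);
        (qc l (curv_alpha a f f' (qe 1) (qe 2)), [:: 4; 5]%N);
        (qc l (curv_alpha a f f' (qe 3) (qe 1)), [:: 6; 4]%N);
        (qc l (curv_alpha a f f' (qe 2) (qe 3)), [:: 5; 6]%N);
        (qc l (curv_omega kappa a f (qe 1) (qe 2)), [:: 0; 1]%N);
        (qc l (curv_omega kappa a f (qe 3) (qe 1)), [:: 2; 0]%N);
        (qc l (curv_omega kappa a f (qe 2) (qe 3)), [:: 1; 2]%N)].
Proof.
split=> // v Tv.
rewrite curv_alpha_expand curv_omega_expand; try exact: omega_imaginary.
rewrite !big_cons big_nil /= !detform2 /coframe /= !(qcD, qcN, qcZ).
ring.
Qed.

(** The seven terms of a G_2 4-form in an adapted coframe; the sign changes come from B^1 = alpha^01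
    - alpha^23 and its cyclic analogues. *)
Lemma expands_dual kappa x T :
  let c1 := 16 * (1 + rr x) `^ (- (2 / 3)) in
  let c2 := - (12 * kappa * (1 + rr x) `^ (1 / 3)) in
  expands (coframe kappa x) T (G2_dual_form (bryant_salamon kappa) x)
    [:: (c1, [:: 3; 4; 5; 6]%N);
        (c2, [:: 1; 2; 3; 4]%N); (- c2, [:: 1; 2; 5; 6]%N);
        (c2, [:: 2; 0; 3; 5]%N); (- c2, [:: 2; 0; 6; 4]%N);
        (c2, [:: 0; 1; 3; 6]%N); (- c2, [:: 0; 1; 4; 5]%N)].
Proof.
have A i := expands_alpha_ kappa x T i.
have W i : (i < 3)%N -> _ := @expands_omega_ kappa x T i.
have A2 i j := expands_wedge (A i) (A j).
have W2 i j (hi : (i < 3)%N) (hj : (j < 3)%N) :=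
  expands_wedge (W i hi) (W j hj).
have P1 := expandsZ (16 * (1 + rr x) `^ (- (2 / 3)))
  (expands_wedge (expands_wedge (A2 0%N 1%N) (A 2%N)) (A 3%N)).
have P2 := expandsZ (12 * kappa * (1 + rr x) `^ (1 / 3))
  (expandsD (expandsD
    (@expands_wedge _ _ _ _ _ _ B1 _ _ _ (W2 1%N 2%N isT isT)
       (expandsB (A2 0%N 1%N) (A2 2%N 3%N)))
    (@expands_wedge _ _ _ _ _ _ B2 _ _ _ (W2 2%N 0%N isT isT)
       (expandsB (A2 0%N 2%N) (A2 3%N 1%N))))
    (@expands_wedge _ _ _ _ _ _ B3 _ _ _ (W2 0%N 1%N isT isT)
       (expandsB (A2 0%N 3%N) (A2 1%N 2%N)))).
have := expandsB P1 P2.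
by rewrite /= !(mulr1, mul1r, mulrN, mulN1r, opprK).
Qed.

End FormExpansions.

Section InstantonEquation.
Context {R : realType}.
Implicit Types (x u w : ambient R) (C kappa f : R) (a p q : quat R).

Lemma detform_eq (e : nat -> ambient R -> R) k s (b : bool) t
    (v : 'I_k -> ambient R) :
  size s = k -> sort_sign s = (b, t) ->
  detform e s v = (-1) ^+ b * detform e t v.
Proof. by move=> sk E; rewrite (detform_sort e v sk) E. Qed.

(** Of the 63 products nine have distinct indices: each omega pair meets alpha^0123, and each alpha
    pair meets the one term of psi_2 with the complementary alpha pair. They group into three
    determinants, all with the same scalar factor. *)
Lemma wedge_dual_eq0 kappa C x (f' : R) (v : 'I_6 -> ambient R) l :
  let f := ff C (rr x) in
  f' + f ^+ 2 = - f / (3 * (1 + rr x)) ->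
  (forall i, tangent_P x (v i)) ->
  rwedge (fun x (w : 'I_2 -> ambient R) => qc l
      (curv_alpha x.2 f f' (alpha x (w 0)) (alpha x (w 1)) +
       curv_omega kappa x.2 f (omega kappa x (w 0)) (omega kappa x (w 1))))
    (G2_dual_form (bryant_salamon kappa)) x v = 0.
Proof.
move=> f Hf Tv; set a := x.2.
have [_ ->] // := @expands_wedge R (coframe kappa x) (tangent_P x) 2 4
  (fun x (w : 'I_2 -> ambient R) => qc l
      (curv_alpha x.2 f f' (alpha x (w 0)) (alpha x (w 1)) +
       curv_omega kappa x.2 f (omega kappa x (w 0)) (omega kappa x (w 1))))
  _ x _ _ (expands_curvature kappa x a f f' l)
  (expands_dual kappa x (tangent_P x)).
set d1 := 16 * _; set d2 := - (12 * _ * _).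
rewrite /= !big_cons big_nil /=.
(* The proof [isT] of non-uniqueness typechecks only for lists with a repeated index, so the nine
   survivors are left alone. *)
repeat match goal with |- context [detform ?e ?s v] =>
  rewrite (@detform_repeat _ e 6 s v erefl isT) end.
set e := coframe kappa x.
set D23 := detform e [:: 1; 2; 3; 4; 5; 6]%N v.
(* The forms contain omega^31, so indices 2 and 0 occur in that order; sorting them costs the sign
   in [E3], [E4] and [E5]. *)
pose D13 := detform e [:: 0; 2; 3; 4; 5; 6]%N v.
set D12 := detform e [:: 0; 1; 3; 4; 5; 6]%N v.
have E1 : detform e [:: 3; 4; 1; 2; 5; 6]%N v = D23.
  by rewrite (@detform_eq _ _ _ false [:: 1; 2; 3; 4; 5; 6]%N) // mul1r.
have E2 : detform e [:: 5; 6; 1; 2; 3; 4]%N v = D23.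
  by rewrite (@detform_eq _ _ _ false [:: 1; 2; 3; 4; 5; 6]%N) // mul1r.
have E3 : detform e [:: 3; 5; 2; 0; 6; 4]%N v = - D13.
  by rewrite (@detform_eq _ _ _ true [:: 0; 2; 3; 4; 5; 6]%N) // mulN1r.
have E4 : detform e [:: 6; 4; 2; 0; 3; 5]%N v = - D13.
  by rewrite (@detform_eq _ _ _ true [:: 0; 2; 3; 4; 5; 6]%N) // mulN1r.
have E5 : detform e [:: 2; 0; 3; 4; 5; 6]%N v = - D13.
  by rewrite (@detform_eq _ _ _ true [:: 0; 2; 3; 4; 5; 6]%N) // mulN1r.
have E6 : detform e [:: 3; 6; 0; 1; 4; 5]%N v = D12.
  by rewrite (@detform_eq _ _ _ false [:: 0; 1; 3; 4; 5; 6]%N) // mul1r.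
have E7 : detform e [:: 4; 5; 0; 1; 3; 6]%N v = D12.
  by rewrite (@detform_eq _ _ _ false [:: 0; 1; 3; 4; 5; 6]%N) // mul1r.
rewrite E1 E2 E3 E4 E5 E6 E7.
move: (curv_alpha_asd a f f') (curv_omega_basis kappa a f).
move: (curv_alpha a f f' (qe 0) (qe 1)) (curv_alpha a f f' (qe 0) (qe 2)).
move: (curv_alpha a f f' (qe 0) (qe 3)) (curv_alpha a f f' (qe 1) (qe 2)).
move: (curv_alpha a f f' (qe 3) (qe 1)) (curv_alpha a f f' (qe 2) (qe 3)).
move: (curv_omega kappa a f (qe 1) (qe 2)) (curv_omega kappa a f (qe 3) (qe 1)).
move: (curv_omega kappa a f (qe 2) (qe 3)).
move=> o23 o12 o31 c31 c23 c03 c12 c01 c02.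
move=> [H1 H2 H3] [-> -> ->].
move/(congr1 (qc l)): H1; move/(congr1 (qc l)): H2; move/(congr1 (qc l)): H3.
rewrite !(qcD, qcN, qcZ).
move: (qc l (qmul _ _)) (qc l (qmul _ _)) (qc l (qmul _ _)) => n1 n2 n3.
move=> /eqP; rewrite subr_eq => /eqP ->.
move=> /eqP; rewrite subr_eq => /eqP ->.
move=> /eqP; rewrite subr_eq => /eqP ->.
(* With 1 + r = s^3 the two terms are - 8 kappa f / s^2 and + 8 kappa f / s^2; this is where the
   differential equation for f is used. *)
have key : d1 * - (kappa / 2 * f) + d2 * (2 * (f' + f ^+ 2)) = 0.
  rewrite /d1 /d2 Hf; have [s0 ts e2] := powR_third (rr1_gt0 x).
  rewrite [1 + _]addrC e2.
  set s := _ `^ _ in s0 ts *; rewrite ts; field; exact: lt0r_neq0.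
transitivity ((d1 * - (kappa / 2 * f) + d2 * (2 * (f' + f ^+ 2))) *
  (n1 * D23 - n2 * D13 + n3 * D12)).
  by ring.
by rewrite key mul0r.
Qed.

End InstantonEquation.

(** * Symmetries, and conclusion *)

Section Geometry.
Context {R : realType}.
Implicit Types (x u w h : ambient R) (C kappa c f : R) (a p q : quat R).

Lemma theta1_linear x : linear (theta1 x).
Proof. by move=> c u w; rewrite /theta1 -qmulZr -qmulDr. Qed.

Lemma theta2_linear x : linear (theta2 x).
Proof. by move=> c u w; rewrite /theta2 -qmulZr -qmulDr. Qed.

Lemma alpha_linear x : linear (alpha x).
Proof.
move=> c u w; rewrite /alpha /phi theta1_linear theta2_linear.
apply: qextl => l; rewrite !(qmulDr, qmulZr).
by rewrite !(qcD, qcN, qcZ, qmulDr, qmulZr); ring.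
Qed.

Lemma A1_linear x : linear (A1 x).
Proof.
move=> c u w; rewrite /A1 alpha_linear qconjD qconjZ qmulDr qmulZr.
by rewrite qimD qimZ.
Qed.

Lemma rr_raction x q : in_SU2 q -> rr (raction x q) = rr x.
Proof. by move=> q1; rewrite /rr /= qnorm2M q1 mulr1. Qed.

Lemma alpha_raction x u q : in_SU2 q ->
  alpha (raction x q) (raction u q) = qmul (alpha x u) q.
Proof.
move=> q1; rewrite /alpha /phi /theta1 /theta2 /= !qconjM -!qmulA -qmulDr.
rewrite !qmulA -qmulDl -qmulZr -qmulZl [RHS]qmulDl qmulNl.
rewrite [qmul _ (qmul (qconj q) _)]qmulA.
by rewrite -[qmul (qmul _ q) _]qmulA SU2_mulqV // qmul1r qmulA.
Qed.

Lemma A1_raction x u q : in_SU2 q ->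
  A1 (raction x q) (raction u q) = A1 x u.
Proof.
move=> q1; rewrite /A1 alpha_raction //= qconjM qmulA -[qmul (qmul _ q) _]qmulA.
by rewrite SU2_mulqV // qmul1r.
Qed.

(** Both theta_i take the value xi on the orbit direction, so their mean phi does too, and da = a xi
    cancels a phi. *)
Lemma alpha_vertical x xi : in_P x -> alpha x (raction x xi) = 0.
Proof.
move=> [x1 x2]; rewrite /alpha /phi /theta1 /theta2 /= !qmulA !SU2_mulVq //.
rewrite qmul1l (_ : 2^-1 *: (xi + xi) = xi) ?subrr //.
by apply: qextl => l; rewrite qcZ qcD; field.
Qed.

Lemma is_connection_instanton C :
  - 3 < C -> is_connection (instanton_form C : kform R 1 _).
Proof.
move=> hC; split.
- move=> x u w c; rewrite /instanton_form A1_linear scalerDr std_repD.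
  by rewrite scalerA mulrC -scalerA std_repZ.
- move=> v; apply: smooth_mx_std_rep; apply: qsmoothZ; first exact: smooth_ff.
  exact: qsmooth_A1.
split.
  move=> q x v q1 xP vT.
  by rewrite /instanton_form (rr_raction x q1) (A1_raction x (v 0) q1).
move=> x v xi i xP vT xi0; rewrite (ord1 i) => v0.
rewrite /instanton_form /A1 v0 alpha_vertical // (_ : qim _ = 0).
  by rewrite scaler0 std_rep0.
by apply: qext; rewrite /qim /qconj !qcE; ring.
Qed.

Lemma qmul0l p : qmul 0 p = 0 :> quat R.
Proof. by apply: qext; rewrite !qcE; ring. Qed.

Lemma curv_alpha0 f (f' : R) p q :
  curv_alpha 0 f f' p q = f *: (qmul p (qconj q) - qmul q (qconj p)).
Proof.
rewrite /curv_alpha !qmul0l (_ : qim 0 = 0) ?qmul0l.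
  by rewrite !scaler0 subrr !scaler0 addr0 add0r.
by apply: qext; rewrite /qim !qcE.
Qed.

Lemma curv_omega0 kappa f p q : curv_omega kappa 0 f p q = 0.
Proof. by rewrite /curv_omega !qmul0l scaler0. Qed.

Lemma nonflat_instanton C : - 3 < C -> nonflat (instanton_form C : kform R 1 _).
Proof.
(* At a = 0 only f alpha /\ conj(alpha) survives; on the fibre vectors 1 and i it equals - 2 f i,
   with f > 0. *)
move=> hC; pose x : ambient R := (qone, qone, 0).
pose v (i : 'I_2) : ambient R := (0, 0, if i == 0 then qe 0 else qe 1).
have xP : in_P x by split; rewrite /in_SU2 /qnorm2 /qconj /= /qone !qcE; ring.
have vT i : tangent_P x (v i) by split; rewrite /imaginary /qconj /= !qcE; ring.
exists x, v; split=> //.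
have [f' [_ Df]] := is_derive_ff x hC.
(* The connection does not involve kappa, so the curvature formula may be taken at kappa = 1. *)
rewrite (curvatureE (ltr01) Df) //.
have al i : alpha x (v i) = (v i).2.
  by rewrite /alpha /=; apply: qext; rewrite !qcE; ring.
have f0 : 0 < ff C (rr x) by rewrite divr_gt0 // ff_den_gt0 // rr_ge0.
apply/eqP => /std_rep_eq0 /(congr1 (qc 1)).
rewrite curv_alpha0 curv_omega0 addr0 !al /= /qe /qconj qc_zero.
rewrite !(qcZ, qcD, qcN, qc_mul, qc_mk) /= => e.
have : ff C (rr x) * 2 = 0 by rewrite -[RHS]oppr0 -[in RHS]e; ring.
by apply/eqP; rewrite mulf_neq0 // gt_eqF.
Qed.

Lemma laction_theta1 h x u : in_SU2cube h ->
  theta1 (laction h x) (laction h u) = theta1 x u.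
Proof.
move=> [h1 _ _]; rewrite /theta1 /= qconjM qmulA.
by rewrite -[qmul (qmul _ _) h.1.1]qmulA SU2_mulVq // qmul1r.
Qed.

Lemma laction_theta2 h x u : in_SU2cube h ->
  theta2 (laction h x) (laction h u) = theta2 x u.
Proof.
move=> [_ h2 _]; rewrite /theta2 /= qconjM qmulA.
by rewrite -[qmul (qmul _ _) h.1.2]qmulA SU2_mulVq // qmul1r.
Qed.

Lemma laction_omega kappa h x u : in_SU2cube h ->
  omega kappa (laction h x) (laction h u) = omega kappa x u.
Proof.
by move=> hh; rewrite /omega (laction_theta1 _ _ hh) (laction_theta2 _ _ hh).
Qed.

Lemma laction_rr h x : in_SU2cube h -> rr (laction h x) = rr x.
Proof. by move=> [_ _ h3]; rewrite /rr /= qnorm2M h3 mul1r. Qed.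

Lemma laction_alpha h x u : in_SU2cube h ->
  alpha (laction h x) (laction h u) = qmul h.2 (alpha x u).
Proof.
move=> hh; rewrite /alpha /phi laction_theta1 // laction_theta2 //=.
by rewrite qmulDr qmulNr qmulA.
Qed.

Lemma sum4 (F : nat -> R) :
  \sum_(0 <= i < 4) F i = F 0%N + F 1%N + F 2%N + F 3%N.
Proof. by rewrite !big_nat_recr //= big_geq // add0r. Qed.

(** The polarised four-square identity. For a unit p it gives invariance of the alpha part of the
    metric, while omega and r are themselves invariant. *)
Lemma qmul_dot p q q' : \sum_(0 <= i < 4) qc i (qmul p q) * qc i (qmul p q') =
  qnorm2 p * \sum_(0 <= i < 4) qc i q * qc i q'.
Proof.
rewrite !sum4 qnorm2E !qc_mul; ring.
Qed.

Lemma isometric_bryant_salamon kappa :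
  SU2cube_isometric (bryant_salamon kappa : G2_structure R).
Proof.
move=> h x u w hh xP uT wT; have [_ _ h3] := hh.
rewrite /= (laction_rr x hh) !(laction_omega _ _ _ hh) !(laction_alpha _ _ hh).
by rewrite qmul_dot h3; congr (_ + _ * _); exact: mul1r.
Qed.

(** The lift does not depend on x, so its derivative drops out and the condition reduces to h_3 A_1
    conj(h_3) h_3 = h_3 A_1. *)
Lemma invariant_instanton C :
  SU2cube_invariant (instanton_form C : kform R 1 _).
Proof.
exists (fun hx => std_rep hx.1.2); split.
- apply: smooth_mx_std_rep; apply: qsmooth_linear => // y.
  apply: (@continuous_comp _ _ _ (fun z : ambient R * ambient R => z.1)
    (fun z : ambient R => z.2 : quat R)); first exact: cvg_fst.
  exact: cvg_snd.
- move=> h x [_ _ h3] xP; split=> //; exact: std_rep_unit.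
- by move=> x xP; exact: std_rep1.
- by move=> h h' x hh hh' xP; rewrite /= std_repM.
move=> h x v hh xP vT; have [_ _ h3] := hh.
rewrite (derive_cmx_std_rep (is_qderive_cst x v h.2)) std_rep0 add0r /=.
rewrite /instanton_form laction_rr // -!std_repM qmulZl qmulZr.
congr (std_rep (_ *: _)); rewrite /A1 laction_alpha //= qconjM qmulA.
rewrite -[qmul (qmul h.2 _) _]qmulA qimM_SU2 // -qmulA SU2_mulVq //.
by rewrite qmul1r.
Qed.

Lemma instanton_bryant_salamon kappa C : 0 < kappa -> - 3 < C ->
  is_G2_instanton (bryant_salamon kappa) (instanton_form C : kform R 1 _).
Proof.
move=> k0 hC; split; first exact: is_connection_instanton.
move=> x v xP vT; have [f' [Hf Df]] := is_derive_ff x hC.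
apply: (@cmx_rwedge_std_rep R 2 4 _ _ x (tangent_P x) (fun z =>
  curv_alpha x.2 (ff C (rr x)) f' (alpha x (z 0)) (alpha x (z 1)) +
  curv_omega kappa x.2 (ff C (rr x))
    (omega kappa x (z 0)) (omega kappa x (z 1)))) => //.
  by move=> w wT; exact: curvatureE.
by move=> m; exact: (wedge_dual_eq0 kappa m Hf vT).
Qed.

End Geometry.

Theorem theorem1p1 (R : realType) (kappa C : R)
    (hkappa : 0 < kappa) (hC : - 3 < C) :
  [/\ is_G2_instanton (bryant_salamon kappa) (instanton_form C),
      nonflat (instanton_form C),
      SU2cube_isometric (bryant_salamon kappa)
    & SU2cube_invariant (instanton_form C)].
Proof.
split; [exact: instanton_bryant_salamon | exact: nonflat_instanton |
  exact: isometric_bryant_salamon | exact: invariant_instanton].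
Qed.
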